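(* Let $d\ge4$ be an even integer and let $\rho=\rho_{AB}$ be a quantum state on $\mathbb{C}^d\otimes\mathbb{C}^d$. (1) If $1\le k\le\frac d2$ and $\mathrm{SN}(\rho)\le k$, then for every skew-symmetric unitary matrix $V\in U(d)$ (i.e. $V^\top=-V$), $$\rho_{AB}+k(I_d\otimes V)\rho_{AB}^\Gamma(I_d\otimes V)^*\le k(\rho_A\otimes I_d),$$ where $\rho_A=(\mathrm{id}_d\otimes\operatorname{Tr})(\rho_{AB})$. (2) For a skew-symmetric unitary matrix $V\in U(d)$ define the real parameters $$a=a(V)=\frac1{d^2-d-2}\big(-1+\operatorname{Tr}(F_d^V\rho)+(d^2-d)\langle\omega_d|\rho|\omega_d\rangle\big),$$ $$b=b(V)=\frac1{d^2-d-2}\big(-1+(d-1)\operatorname{Tr}(F_d^V\rho)+d\langle\omega_d|\rho|\omega_d\rangle\big),$$ where $F_d^V=(I_d\otimes V)F_d(I_d\otimes V)^*$. If $1\le k\le d$ and $\mathrm{SN}(\rho)\le k$, then $(a,b)\in\mathbb{S}_k$.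
   Context: $\Omega_d=\begin{pmatrix}0&I_{d/2}\\-I_{d/2}&0\end{pmatrix}$, $|\omega_d\rangle=\frac1{\sqrt d}\sum_{j=1}^d|jj\rangle$, $F_d=\sum_{i,j=1}^d|ij\rangle\langle ji|$, $\rho^\Gamma=(\mathrm{id}\otimes\top)(\rho)$. A quantum state is a positive semidefinite trace-one matrix; its Schmidt number $\mathrm{SN}(\rho)$ is the smallest $k$ such that $\rho$ is a convex combination of pure states $|\xi\rangle\langle\xi|$ with $\xi$ of Schmidt rank at most $k$. Matrix inequalities are in the Loewner (positive semidefinite) order. $\mathbb{S}_k$ denotes the set of $(a,b)\in\mathbb{R}^2$ such that $$\rho_{a,b}=\frac{1-a-b}{d^2}I_d\otimes I_d+a|\omega_d\rangle\langle\omega_d|+\frac bd(I_d\otimes\Omega_d)F_d(I_d\otimes\Omega_d)^*$$ is a quantum state with $\mathrm{SN}(\rho_{a,b})\le k$. *)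

(* Defs.v *)
From HB Require Import structures.
From mathcomp Require Import all_boot all_order all_algebra.
From mathcomp Require Import boolp classical_sets reals.
From mathcomp.real_closed Require Import complex mxtens.

Set Implicit Arguments.
Unset Strict Implicit.
Unset Printing Implicit Defensive.

Import Order.TTheory GRing.Theory Num.Theory.
Local Open Scope ring_scope.
Local Open Scope complex_scope.
Local Open Scope sesquilinear_scope.

(* C^d (x) C^d is identified with C^(d * d) through mxtens: the basis vector
   |ij> has index mxtens_index (i, j), and *t is the Kronecker product. *)

Section States.
Variable C : numClosedFieldType.

Definition psdmx n (A : 'M[C]_n) : Prop :=
  A \is hermsymmx /\ forall v : 'cV[C]_n, 0 <= (v^t* *m A *m v) 0 0.

Definition loewner_le n (A B : 'M[C]_n) : Prop := psdmx (B - A).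

Definition quantum_state n (rho : 'M[C]_n) : Prop := psdmx rho /\ \tr rho = 1.

Definition unit_vector n (xi : 'cV[C]_n) : Prop := xi^t* *m xi = 1%:M.

Definition ketbra n (xi : 'cV[C]_n) : 'M[C]_n := xi *m xi^t*.

Section Bipartite.
Variable d : nat.

Definition coef_mx (xi : 'cV[C]_(d * d)) : 'M[C]_d :=
  \matrix_(i, j) xi (mxtens_index (i, j)) 0.

(* [schmidt_rank_leP]: at most k iff xi is a sum of k product vectors. *)
Definition schmidt_rank (xi : 'cV[C]_(d * d)) : nat := \rank (coef_mx xi).

(* The weights are real: 0 <= p i in a numClosedFieldType forces it. *)
Definition schmidt_decomposable (k : nat) (rho : 'M[C]_(d * d)) : Prop :=
  exists (n : nat) (p : 'I_n -> C) (xi : 'I_n -> 'cV[C]_(d * d)),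
    [/\ forall i, 0 <= p i,
        \sum_i p i = 1,
        forall i, unit_vector (xi i) /\ (schmidt_rank (xi i) <= k)%N
      & rho = \sum_i p i *: ketbra (xi i)].

(* The default value 0 is never taken on a quantum state: see
   [schmidt_numberP]. *)
Definition schmidt_number (rho : 'M[C]_(d * d)) : nat :=
  xget 0%N [set k | schmidt_decomposable k rho /\
                    forall j, schmidt_decomposable j rho -> (k <= j)%N].

(* id (x) transpose, i.e. <ij|rho^Gamma|kl> = <il|rho|kj>. *)
Definition ptranspose (rho : 'M[C]_(d * d)) : 'M[C]_(d * d) :=
  \matrix_(p, q)
    rho (mxtens_index ((mxtens_unindex p).1, (mxtens_unindex q).2))
        (mxtens_index ((mxtens_unindex q).1, (mxtens_unindex p).2)).

Definition ptrace (rho : 'M[C]_(d * d)) : 'M[C]_d :=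
  \matrix_(i, j) \sum_l rho (mxtens_index (i, l)) (mxtens_index (j, l)).

Definition ket2 (i j : 'I_d) : 'cV[C]_(d * d) :=
  (delta_mx i 0 : 'cV[C]_d) *t (delta_mx j 0 : 'cV[C]_d).

Definition omega_ket : 'cV[C]_(d * d) := (sqrtC d%:R)^-1 *: \sum_j ket2 j j.

Definition flip : 'M[C]_(d * d) := \sum_i \sum_j ket2 i j *m (ket2 j i)^t*.

Definition conjB (V : 'M[C]_d) (X : 'M[C]_(d * d)) : 'M[C]_(d * d) :=
  (1%:M *t V) *m X *m (1%:M *t V)^t*.

(* For even d, the block matrix with rows (0, I) and (-I, 0): see
   [Omega_block]. *)
Definition Omega : 'M[C]_d :=
  \matrix_(i, j) ((j == i + d./2 :> nat)%N%:R - (i == j + d./2 :> nat)%N%:R).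

Definition rho_ab (a b : C) : 'M[C]_(d * d) :=
  ((1 - a - b) / d%:R ^+ 2) *: (1%:M *t 1%:M)
  + a *: ketbra omega_ket
  + (b / d%:R) *: conjB Omega flip.

Definition omega_fid (rho : 'M[C]_(d * d)) : C :=
  (omega_ket^t* *m rho *m omega_ket) 0 0.

Definition flip_val (V : 'M[C]_d) (rho : 'M[C]_(d * d)) : C :=
  \tr (conjB V flip *m rho).

Definition a_param (V : 'M[C]_d) (rho : 'M[C]_(d * d)) : C :=
  (d%:R ^+ 2 - d%:R - 2)^-1 *
  (- 1 + flip_val V rho + (d%:R ^+ 2 - d%:R) * omega_fid rho).

Definition b_param (V : 'M[C]_d) (rho : 'M[C]_(d * d)) : C :=
  (d%:R ^+ 2 - d%:R - 2)^-1 *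
  (- 1 + (d%:R - 1) * flip_val V rho + d%:R * omega_fid rho).

Lemma state_decomposable (rho : 'M[C]_(d * d)) :
  quantum_state rho -> schmidt_decomposable d rho.
Proof.
case=> -[herm pos] tr1.
set P := spectralmx rho; set sp := spectral_diag rho.
have Pu : P \is unitarymx by exact: spectral_unitarymx.
have rhoE : rho = P^t* *m diag_mx sp *m P.
  rewrite -(invmx_unitary Pu).
  exact/orthomx_spectralP/hermitian_normalmx.
have PP : P *m P^t* = 1%:M by apply/unitarymxP.
pose xi i : 'cV[C]_(d * d) := (row i P)^t*.
have xiK i : (xi i)^t* = row i P by rewrite trmxCK.
have rhoS : rho = \sum_i sp 0 i *: ketbra (xi i).
  rewrite [LHS]rhoE; apply/matrixP => x y.
  rewrite -mulmxA mul_diag_mx !mxE summxE; apply: eq_bigr => i _.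
  by rewrite /ketbra xiK !mxE big_ord1 !mxE mulrCA.
have spE i : sp 0 i = ((xi i)^t* *m rho *m xi i) 0 0.
  have -> : (xi i)^t* *m rho *m xi i = row i (P *m rho) *m (row i P)^t*.
    by rewrite xiK row_mul.
  rewrite rhoE !mulmxA PP mul1mx.
  have -> : row i (diag_mx sp *m P) *m (row i P)^t* =
            sp 0 i *: (row i P *m (row i P)^t*).
    rewrite scalemxAl; congr (_ *m _); apply/rowP => j.
    by rewrite mul_diag_mx !mxE.
  have -> : row i P *m (row i P)^t* = 1%:M.
    apply/matrixP => x y; rewrite !ord1 [RHS]mxE eqxx.
    move/matrixP: PP => /(_ i i); rewrite [RHS]mxE eqxx => <-.
    by rewrite !mxE; apply: eq_bigr => j _; rewrite !mxE.
  by rewrite !mxE mulr1.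
have xi1 i : unit_vector (xi i).
  rewrite /unit_vector xiK; apply/matrixP => x y; rewrite !ord1 [RHS]mxE eqxx.
  move/matrixP: PP => /(_ i i); rewrite [RHS]mxE eqxx => <-.
  by rewrite !mxE; apply: eq_bigr => j _; rewrite !mxE.
have sp0 i : 0 <= sp 0 i by rewrite spE.
exists (d * d)%N, (fun i => sp 0 i), xi; split=> //.
- rewrite -tr1 rhoS raddf_sum; apply: eq_bigr => i _ /=.
  by rewrite mxtraceZ /ketbra mxtrace_mulC xi1 mxtrace1 mulr1.
- by move=> i; split; rewrite // rank_leq_row.
Qed.

Lemma schmidt_numberP (rho : 'M[C]_(d * d)) : quantum_state rho ->
  schmidt_decomposable (schmidt_number rho) rho /\
  forall j, schmidt_decomposable j rho -> (schmidt_number rho <= j)%N.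
Proof.
move=> /state_decomposable dec; rewrite /schmidt_number.
case: xgetP => [_ -> //|none].
have ex : exists k, `[< schmidt_decomposable k rho >].
  by exists d; apply/asboolP.
have [m /asboolP decm minm] := ex_minnP ex.
by case: (none m); split=> // j /asboolP; apply: minm.
Qed.

Lemma schmidt_number_leP (rho : 'M[C]_(d * d)) (k : nat) :
  quantum_state rho ->
  (schmidt_number rho <= k)%N <-> schmidt_decomposable k rho.
Proof.
move=> /schmidt_numberP[dec minsn]; split; last exact: minsn.
case: dec => n [p [xi [p0 p1 xiP rhoE]]] lek.
exists n, p, xi; split=> // i; have [xi1 le_sn] := xiP i.
by split=> //; apply: leq_trans le_sn lek.
Qed.

Lemma schmidt_rank_leP (xi : 'cV[C]_(d * d)) (k : nat) :
  (schmidt_rank xi <= k)%N <->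
  exists (v w : 'I_k -> 'cV[C]_d), xi = \sum_i (v i *t w i : 'cV[C]_(d * d)).
Proof.
have E (v w : 'I_k -> 'cV[C]_d) :
    xi = \sum_i (v i *t w i : 'cV[C]_(d * d)) <->
    coef_mx xi = (\matrix_(x, l) v l x 0) *m (\matrix_(l, x) w l x 0).
  split=> [->|/matrixP H].
    apply/matrixP => i j; rewrite !mxE !summxE; apply: eq_bigr => l _.
    by rewrite !mxE mxtens_indexK !ord1.
  apply/matrixP => x y; rewrite !ord1; case: (mxtens_indexP x) => i j.
  have := H i j; rewrite !mxE !summxE => ->; apply: eq_bigr => l _.
  by rewrite !mxE mxtens_indexK !ord1.
split=> [lek|[v [w /E]]]; last first.
  rewrite /schmidt_rank => ->.
  exact: leq_trans (mxrankM_maxl _ _) (rank_leq_col _).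
pose A : 'M_(d, k) := col_ebase (coef_mx xi) *m pid_mx (schmidt_rank xi).
pose B : 'M_(k, d) := pid_mx (schmidt_rank xi) *m row_ebase (coef_mx xi).
exists (fun l => col l A), (fun l => (row l B)^T); apply/E.
have -> : \matrix_(x, l) col l A x 0 = A by apply/matrixP => x l; rewrite !mxE.
have -> : \matrix_(l, x) (row l B)^T x 0 = B.
  by apply/matrixP => l x; rewrite !mxE.
rewrite /A /B mulmxA -(mulmxA _ (pid_mx _) (pid_mx _)) pid_mx_id //.
by rewrite mulmx_ebase.
Qed.

End Bipartite.

Lemma Omega_block m :
  Omega (m + m) = block_mx 0 1%:M (- 1%:M) 0 :> 'M[C]_(m + m).
Proof.
have lt_neq (i : 'I_m) (c : nat) : (i == c + m :> nat)%N = false.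
  by apply/eqP => e; have := ltn_ord i; rewrite e ltnNge leq_addl.
have half : (m + m)./2 = m by rewrite addnn doubleK.
apply/matrixP => i j; rewrite mxE half.
case: (split_ordP i) => i' ->; case: (split_ordP j) => j' ->.
- by rewrite block_mxEul !mxE /= !lt_neq subr0.
- rewrite block_mxEur !mxE /= lt_neq subr0 (addnC i').
  by rewrite eqn_add2l eq_sym.
- rewrite block_mxEdl !mxE /= lt_neq sub0r (addnC j').
  by rewrite eqn_add2l.
- by rewrite block_mxEdr !mxE /= -!addnA !eqn_add2l !lt_neq subr0.
Qed.

End States.

Definition Sset (R : realType) (d k : nat) : set (R * R) :=
  [set ab | let rho := rho_ab d (ab.1%:C : R[i]) ab.2%:C in
            quantum_state rho /\ (schmidt_number rho <= k)%N].

(* Main.v *)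
Require Import Defs.
From HB Require Import structures.
From mathcomp Require Import all_boot all_order all_algebra all_fingroup.
From mathcomp Require Import boolp classical_sets reals.
From mathcomp.real_closed Require Import complex mxtens.
From mathcomp Require Import separable cyclotomic ring.

(* A vector of C^d (x) C^d is a matrix M, its Schmidt rank is the rank of M, and
   U (x) conj U acts by M |-> U M U^*.

   (1) For a pure state M and a test vector N, put X = M^* N, of rank <= k. With
   W = conj V, the map X |-> W X^T W^* is an isometric involution because W is
   skew-symmetric; S = X + W X^T W^* has rank <= 2k and trace 2 tr X, so that
   |tr S|^2 <= 2k ||S||^2, which is exactly the required inequality.

   (2) V is congruent to Omega by a unitary, so one may take V = Omega. The state
   rho_{a,b} is then the average of rho over U (x) conj U for U unitary and
   symplectic, and such an average does not increase the Schmidt number. To avoid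
   Haar measure and compactness, the average is replaced by a finite one. Write
   C^d as m = d/2 sites carrying a spin 1/2. Averaging over the quaternion group
   at each site, the site permutations and a global unit quaternion of order 3
   leaves the span of five operators: 1, |1><1|, the twisted flip, and two
   site-dependent ones D1, D2. Let g = diag(F, conj F) with F a Fourier matrix.
   Modulo the first three operators, conjugation by g followed by the same
   average acts on the span of D1 and D2 as the scalar -1/d; hence the mixture of
   the identity and of g with weights 1/(d+1) and d/(d+1) kills D1 and D2. *)

Set Implicit Arguments.
Unset Strict Implicit.
Unset Printing Implicit Defensive.

Import Order.TTheory GRing.Theory Num.Theory.
Local Open Scope ring_scope.
Local Open Scope sesquilinear_scope.

Local Notation "A ^cj" := (map_mx Num.conj A) (at level 30) : ring_scope.

(** * Vectorization *)

Ltac conj_simp := repeat progress (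
  rewrite /= ?(rmorphB, rmorphD, rmorphM, rmorphN, fmorphV, rmorph_nat,
    rmorph1, rmorph0, conjCi) /=).

Section Vectorization.
Variables (C : numClosedFieldType) (d : nat).
Implicit Types (A B M N U : 'M[C]_d) (X Y : 'M[C]_(d * d)).

Lemma sum_pair (F : 'I_(d * d) -> C) :
  \sum_p F p = \sum_i \sum_j F (mxtens_index (i, j)).
Proof.
rewrite pair_big /=; apply: reindex.
exists (@mxtens_unindex d d) => [[i j]|p] _ /=; last exact: mxtens_unindexK.
exact: mxtens_indexK.
Qed.

(** The matrix element <ij|X|kl>. *)
Definition ent X i j k l := X (mxtens_index (i, j)) (mxtens_index (k, l)).

Lemma entP X Y : (forall i j k l, ent X i j k l = ent Y i j k l) -> X = Y.
Proof.
move=> eqXY; apply/matrixP => p q.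
by case: (mxtens_indexP p) (mxtens_indexP q) => i j [k l]; apply: eqXY.
Qed.

Definition vecm M : 'cV[C]_(d * d) :=
  \col_p M (mxtens_unindex p).1 (mxtens_unindex p).2.

Lemma vecmE M i j : vecm M (mxtens_index (i, j)) 0 = M i j.
Proof. by rewrite mxE mxtens_indexK. Qed.

Lemma vecmK : cancel vecm (@coef_mx C d).
Proof. by move=> M; apply/matrixP => i j; rewrite mxE vecmE. Qed.

Lemma coef_mxK : cancel (@coef_mx C d) vecm.
Proof.
move=> xi; apply/matrixP => p q; rewrite ord1; case: (mxtens_indexP p) => i j.
by rewrite vecmE mxE.
Qed.

Lemma tensmx_vecm A B M : (A *t B) *m vecm M = vecm (A *m M *m B^T).
Proof.
apply/matrixP => p q; rewrite ord1; case: (mxtens_indexP p) => i j.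
rewrite vecmE !mxE sum_pair exchange_big /=; apply: eq_bigr => l _.
rewrite mxE big_distrl /=; apply: eq_bigr => k _.
by rewrite tensmxE vecmE !mxE mulrAC.
Qed.

Lemma dot_vecm M N : (vecm N)^t* *m vecm M = (\tr (N^t* *m M))%:M.
Proof.
apply/matrixP => x y; rewrite !ord1 !mxE sum_pair exchange_big /= mulr1n.
apply: eq_bigr => j _; rewrite mxE; apply: eq_bigr => i _.
by rewrite !mxE !mxtens_indexK.
Qed.

Lemma trmxC_mul p q r (A : 'M[C]_(p, q)) (B : 'M[C]_(q, r)) :
  (A *m B)^t* = B^t* *m A^t*.
Proof. by rewrite trmx_mul map_mxM. Qed.

Lemma trmxCZ p q (c : C) (A : 'M[C]_(p, q)) : (c *: A)^t* = c^* *: A^t*.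
Proof. by rewrite linearZ map_mxZ. Qed.

Lemma trmxCD p q (A B : 'M[C]_(p, q)) : (A + B)^t* = A^t* + B^t*.
Proof. by rewrite linearD map_mxD. Qed.

Lemma trmxC_tens A B : (A *t B)^t* = A^t* *t B^t*.
Proof. by rewrite trmx_tens map_mxT. Qed.

Lemma trmxC_conj p q (A : 'M[C]_(p, q)) : (A^cj)^t* = A^T.
Proof. by apply/matrixP => i j; rewrite !mxE conjCK. Qed.

Lemma tens1mx1 : (1%:M : 'M[C]_d) *t (1%:M : 'M[C]_d) = 1%:M.
Proof.
apply/entP => i j k l; rewrite /ent tensmxE !mxE.
by rewrite (can_eq (@mxtens_indexK d d)) xpair_eqE -natrM mulnb.
Qed.

(** The action to be averaged. On [vecm M] the operator U (x) conj U acts as M |-> U M U^*, so for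
    unitary U it fixes the maximally entangled vector and in all cases it does not raise the Schmidt
    rank. *)
Definition tw U X := (U *t U^cj) *m X *m (U *t U^cj)^t*.

Lemma twM U V X : tw (U *m V) X = tw U (tw V X).
Proof.
by rewrite /tw map_mxM -tensmx_mul trmxC_mul !mulmxA.
Qed.

Lemma tw1 X : tw 1%:M X = X.
Proof. by rewrite /tw map_mx1 tens1mx1 trmx1 map_mx1 mul1mx mulmx1. Qed.

Lemma twN U X : tw (- U) X = tw U X.
Proof.
rewrite /tw; suff -> : (- U) *t (- U)^cj = U *t U^cj by [].
by apply/entP => i j k l; rewrite /ent !tensmxE !mxE rmorphN mulrNN.
Qed.

Lemma tw_is_linear U : linear (tw U).
Proof.
by move=> a X Y; rewrite /tw mulmxDr mulmxDl -scalemxAr -scalemxAl.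
Qed.
HB.instance Definition _ U :=
  GRing.isLinear.Build C 'M[C]_(d * d) 'M[C]_(d * d) _ (tw U) (tw_is_linear U).

Lemma tw_ketbra U M : tw U (ketbra (vecm M)) = ketbra (vecm (U *m M *m U^t*)).
Proof.
have trU : U^cj^T = U^t* by apply/matrixP => i j; rewrite !mxE.
by rewrite /tw /ketbra !mulmxA tensmx_vecm trU -mulmxA -trmxC_mul tensmx_vecm trU.
Qed.

Lemma tw_unitary U : U \is unitarymx -> (U *t U^cj)^t* *m (U *t U^cj) = 1%:M.
Proof.
move=> /unitarymxP/mulmx1C Uu; rewrite trmxC_tens trmxC_conj tensmx_mul Uu.
have -> : U^T *m U^cj = 1%:M.
  by rewrite -[LHS]trmxK trmx_mul trmxK map_trmx Uu trmx1.
exact: tens1mx1.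
Qed.

Lemma mxtrace_tw U X : U \is unitarymx -> \tr (tw U X) = \tr X.
Proof.
by move=> Uu; rewrite /tw mxtrace_mulC mulmxA tw_unitary // mul1mx.
Qed.

Lemma twT U X Y : U \is unitarymx -> \tr (Y *m tw U X) = \tr (tw (U^t*) Y *m X).
Proof.
move=> Uu; rewrite /tw mxtrace_mulC -mulmxA [RHS]mxtrace_mulC.
rewrite [in RHS]mulmxA [in RHS]mxtrace_mulC.
have -> : U^t* *t U^t*^cj = (U *t U^cj)^t*.
  rewrite trmxC_tens trmxC_conj; congr (_ *t _).
  by apply/matrixP => i j; rewrite !mxE conjCK.
by rewrite trmxCK !mulmxA mxtrace_mulC !mulmxA.
Qed.

Lemma tw_tens U A B :
  tw U (A *t B) = (U *m A *m U^t*) *t (U^cj *m B *m U^T).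
Proof. by rewrite /tw trmxC_tens trmxC_conj !tensmx_mul. Qed.

Lemma entE_tw U X i j k l : ent (tw U X) i j k l =
  \sum_i' \sum_j' \sum_k' \sum_l'
    U i i' * (U j j')^* * (U k k')^* * U l l' * ent X i' j' k' l'.
Proof.
rewrite /ent /tw mxE.
transitivity (\sum_k' \sum_l' \sum_i' \sum_j'
   U i i' * (U j j')^* * (U k k')^* * U l l' * ent X i' j' k' l').
  rewrite sum_pair; apply: eq_bigr => k' _; apply: eq_bigr => l' _.
  rewrite mxE sum_pair big_distrl /=; apply: eq_bigr => i' _.
  rewrite big_distrl /=; apply: eq_bigr => j' _.
  by rewrite !mxE !mxtens_indexK /= rmorphM /= conjCK /ent; ring.
under eq_bigr do rewrite exchange_big /=.
rewrite exchange_big /=; apply: eq_bigr => i' _.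
under eq_bigr do rewrite exchange_big /=.
by rewrite exchange_big /=.
Qed.

End Vectorization.

(** * Spins and sites *)

Section Sites.
Variables (C : numClosedFieldType) (m : nat).
Local Notation d := (m + m)%N.

(* C^d is identified with C^2 (x) C^m, spin times site, in such a way that
   [Omega] acts on the spin only. *)
Definition idx (s : bool) (a : 'I_m) : 'I_d := if s then rshift m a else lshift m a.
Arguments idx : simpl never.
Definition spin (i : 'I_d) : bool := if split i is inr _ then true else false.
Definition site (i : 'I_d) : 'I_m := match split i with inl a => a | inr a => a end.

Lemma spinE s a : spin (idx s a) = s.
Proof.
by case: s; rewrite /spin /idx; [rewrite (unsplitK (inr a)) | rewrite (unsplitK (inl a))].
Qed.

Lemma siteE s a : site (idx s a) = a.
Proof.
by case: s; rewrite /site /idx; [rewrite (unsplitK (inr a)) | rewrite (unsplitK (inl a))].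
Qed.

Lemma idxK i : idx (spin i) (site i) = i.
Proof. by rewrite /idx /spin /site; case: (split_ordP i) => a ->. Qed.

Lemma idx_eq s a t b : (idx s a == idx t b) = (s == t) && (a == b).
Proof.
apply/eqP/andP => [E|[/eqP-> /eqP-> //]].
by move: (congr1 spin E) (congr1 site E); rewrite !spinE !siteE => -> ->.
Qed.

Lemma idxP (P : 'I_d -> Prop) : (forall s a, P (idx s a)) -> forall i, P i.
Proof. by move=> H i; rewrite -(idxK i); apply: H. Qed.

Lemma sum_idx (V : nmodType) (F : 'I_d -> V) :
  \sum_i F i = \sum_a (F (idx false a) + F (idx true a)).
Proof. by rewrite big_split_ord /= big_split. Qed.

(** Operators that are block diagonal in the site, with the 2 x 2 block [w a] acting on the spin at
    site a. *)
Definition bmx (w : 'I_m -> bool -> bool -> C) : 'M[C]_d :=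
  \matrix_(i, j) ((site i == site j)%:R * w (site i) (spin i) (spin j)).

Lemma bmxE w s a t b : bmx w (idx s a) (idx t b) = (a == b)%:R * w a s t.
Proof. by rewrite mxE !siteE !spinE. Qed.

Lemma eq_bmx w w' : (forall a s t, w a s t = w' a s t) -> bmx w = bmx w'.
Proof. by move=> eqw; apply/matrixP => i j; rewrite !mxE eqw. Qed.

Lemma bmx_mul w w' : bmx w *m bmx w' =
  bmx (fun a s t => w a s false * w' a false t + w a s true * w' a true t).
Proof.
apply/matrixP; elim/idxP => s a; elim/idxP => t b.
rewrite mxE sum_idx bmxE (bigD1 a) //= big1 ?addr0 => [|c /negPf ca].
  rewrite !bmxE eqxx !mul1r; case: eqVneq => [->|_]; first by rewrite !mul1r.
  by rewrite !mul0r !mulr0 addr0.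
by rewrite !bmxE eq_sym ca !mul0r addr0.
Qed.

Lemma bmx_trC w : (bmx w)^t* = bmx (fun a s t => (w a t s)^*).
Proof.
apply/matrixP; elim/idxP => s a; elim/idxP => t b.
rewrite 2!mxE !bmxE rmorphM rmorph_nat eq_sym.
by case: eqVneq => [->|]; rewrite ?mul0r.
Qed.

Lemma bmx_tr w : (bmx w)^T = bmx (fun a s t => w a t s).
Proof.
apply/matrixP; elim/idxP => s a; elim/idxP => t b.
by rewrite mxE !bmxE eq_sym; case: eqVneq => [->|]; rewrite ?mul0r.
Qed.

Lemma bmx_opp w : - bmx w = bmx (fun a s t => - w a s t).
Proof. by apply/matrixP => i j; rewrite !mxE mulrN. Qed.

Lemma bmx1 : 1%:M = bmx (fun _ s t => (s == t)%:R).
Proof.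
apply/matrixP; elim/idxP => s a; elim/idxP => t b.
by rewrite mxE bmxE idx_eq -natrM mulnb andbC.
Qed.

(** The antisymmetric 2 x 2 block of [Omega] at each site. *)
Definition sgn2 (s t : bool) : C := if s == t then 0 else if s then -1 else 1.

Lemma Omega_bmx : Omega C d = bmx (fun _ => sgn2).
Proof.
apply/matrixP; elim/idxP => s a; elim/idxP => t b; rewrite bmxE mxE /sgn2.
have -> : (m + m)./2 = m by rewrite addnn doubleK.
rewrite /idx.
have N (x : 'I_m) n : (x == n + m :> nat)%N = false.
  by apply/negbTE; rewrite neq_ltn (leq_trans (ltn_ord x)) ?leq_addl.
case: s; case: t; rewrite /= ?N ?subr0 ?sub0r.
- by rewrite -addnA eqn_add2l N -addnA eqn_add2l N subrr mulr0.
- by rewrite addnC eqn_add2r mulrN1.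
- by rewrite addnC eqn_add2r mulr1 eq_sym.
- by rewrite mulr0.
Qed.

(** The rank 2 orthogonal projection onto the spin space of site x. *)
Definition sitepr (x : 'I_m) : 'M[C]_d := bmx (fun a s t => ((a == x) && (s == t))%:R).

(* The quaternion p + q j as a 2 x 2 matrix. *)
Definition quat (p q : C) (s t : bool) : C :=
  match s, t with
  | false, false => p | false, true => q | true, false => - q^* | true, true => p^*
  end.

Definition qmx (p q : 'I_m -> C) : 'M[C]_d := bmx (fun a => quat (p a) (q a)).

(** At each site this is the product (p + q j)(p' + q' j) of quaternions, with j z = conj z j. *)
Lemma qmx_mul p q p' q' : qmx p q *m qmx p' q' =
  qmx (fun a => p a * p' a - q a * (q' a)^*) (fun a => p a * q' a + q a * (p' a)^*).
Proof.
rewrite bmx_mul; apply: eq_bmx => a s t; case: s; case: t => /=;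
  rewrite ?rmorphB ?rmorphD ?rmorphM /= ?conjCK; ring.
Qed.

Lemma eq_qmx p q p' q' :
  (forall a, p a = p' a) -> (forall a, q a = q' a) -> qmx p q = qmx p' q'.
Proof. by move=> ep eq; apply: eq_bmx => a s t; rewrite ep eq. Qed.

Lemma qmx_opp p q : - qmx p q = qmx (fun a => - p a) (fun a => - q a).
Proof.
by rewrite bmx_opp; apply: eq_bmx => a s t; case: s; case: t; rewrite /= ?rmorphN.
Qed.

Lemma qmx1 : qmx (fun=> 1) (fun=> 0) = 1%:M.
Proof.
rewrite bmx1; apply: eq_bmx => a s t.
by case: s; case: t; rewrite /= ?rmorph0 ?rmorph1 ?oppr0.
Qed.

(** The first two clauses make U (x) conj U fix the identity, the maximally entangled state and the
    twisted flip. The third one, that the site projections are permuted, makes it fix the two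
    site-dependent operators as well. *)
Definition site_symp (U : 'M[C]_d) : Prop :=
  [/\ U \is unitarymx, U *m Omega C d *m U^T = Omega C d &
      exists s : 'S_m, forall x, U *m sitepr x *m U^t* = sitepr (s x)].

(** A unit quaternion is an element of SU(2) = Sp(1), hence preserves the antisymmetric form at its
    site; the blocks commute with all site projections. *)
Lemma qmx_site_symp p q :
  (forall a, p a * (p a)^* + q a * (q a)^* = 1) -> site_symp (qmx p q).
Proof.
move=> n1; split.
- apply/unitarymxP; rewrite bmx_trC bmx_mul bmx1; apply: eq_bmx => a s t.
  case: s; case: t => /=; rewrite ?rmorphN /= ?conjCK.
  + by rewrite -(n1 a); ring.
  + by ring.
  + by ring.
  + by rewrite n1.
- rewrite Omega_bmx bmx_tr !bmx_mul; apply: eq_bmx => a s t.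
  case: s; case: t; rewrite /sgn2 /=; first by ring.
  + by rewrite -[in RHS](n1 a); ring.
  + by rewrite -[in RHS](n1 a); ring.
  + by ring.
- exists 1%g => x; rewrite perm1 bmx_trC !bmx_mul; apply: eq_bmx => a s t.
  case: eqVneq => [_|_]; last by rewrite /= !mulr0 !addr0 !mul0r addr0.
  case: s; case: t; rewrite /= ?rmorphN /= ?conjCK.
  + by rewrite -[in RHS](n1 a); ring.
  + by ring.
  + by ring.
  + by rewrite -[in RHS](n1 a); ring.
Qed.

Definition pmx (s : 'S_m) : 'M[C]_d :=
  \matrix_(i, j) ((spin i == spin j) && (site i == s (site j)))%:R.

Lemma pmxE s u a v b :
  pmx s (idx u a) (idx v b) = ((u == v) && (a == s b))%:R.
Proof. by rewrite mxE !siteE !spinE. Qed.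

(** Permutations compose from left to right: [t * s] applies t first. *)
Lemma pmx_mul s t : pmx s *m pmx t = pmx (t * s)%g.
Proof.
apply/matrixP; elim/idxP => u a; elim/idxP => v b.
rewrite mxE sum_idx (bigD1 (t b)) //= big1 ?addr0 => [|c /negPf cb].
  rewrite !pmxE permM !eqxx !andbT.
  by case: u; case: v; rewrite /= ?mul0r ?mulr0 ?mulr1 ?addr0 ?add0r.
by rewrite !pmxE cb !andbF !mulr0 addr0.
Qed.

Lemma pmx1 : pmx 1%g = 1%:M.
Proof.
apply/matrixP; elim/idxP => u a; elim/idxP => v b.
by rewrite pmxE perm1 mxE idx_eq.
Qed.

Lemma eq_permV (s : 'S_m) x y : (x == s^-1%g y) = (s x == y).
Proof. by apply/eqP/eqP => [->|<-]; rewrite ?permKV ?permK. Qed.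

Lemma pmx_trC s : (pmx s)^t* = pmx s^-1%g.
Proof.
apply/matrixP; elim/idxP => u a; elim/idxP => v b.
rewrite 2!mxE !pmxE rmorph_nat eq_permV [v == u]eq_sym.
by rewrite [b == s a]eq_sym.
Qed.

Lemma pmx_bmx s w : pmx s *m bmx w = bmx (fun a => w (s^-1%g a)) *m pmx s.
Proof.
apply/matrixP; elim/idxP => u a; elim/idxP => v b.
rewrite !mxE !sum_idx (bigD1 (s^-1%g a)) //= big1 ?addr0 => [|c ca]; last first.
  by rewrite !pmxE [a == _]eq_sym -eq_permV (negPf ca) !andbF !mul0r addr0.
rewrite [RHS](bigD1 a) //= big1 ?addr0 => [|c ca]; last first.
  by rewrite !bmxE eq_sym (negPf ca) !mul0r addr0.
rewrite !pmxE !bmxE permKV !eqxx !andbT !mul1r [_ == b]eq_sym eq_permV [s b == a]eq_sym.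
by case: (a == s b); case: u; case: v; rewrite /= ?(mul0r,mulr0,mul1r,mulr1,addr0,add0r).
Qed.

Lemma pmx_qmx s p q :
  pmx s *m qmx p q = qmx (fun a => p (s^-1%g a)) (fun a => q (s^-1%g a)) *m pmx s.
Proof. exact: pmx_bmx. Qed.

Lemma pmx_site_symp s : site_symp (pmx s).
Proof.
have trE : (pmx s)^T = pmx s^-1%g.
  by rewrite -pmx_trC; apply/matrixP => i j; rewrite !mxE rmorph_nat.
split.
- by apply/unitarymxP; rewrite pmx_trC pmx_mul mulVg pmx1.
- by rewrite Omega_bmx pmx_bmx trE -mulmxA pmx_mul mulVg pmx1 mulmx1.
- exists s => x; rewrite pmx_bmx pmx_trC -mulmxA pmx_mul mulVg pmx1 mulmx1.
  apply: eq_bmx => a u v.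
  by rewrite [_ == x]eq_sym eq_permV eq_sym.
Qed.

End Sites.
Arguments idx : simpl never.

(** * Finite averages *)

Section Averaging.
Variables (C : numClosedFieldType) (m : nat).
Local Notation d := (m + m)%N.
Local Notation op := 'M[C]_(d * d).
Implicit Types (X Y Z : op) (u v : 'M[C]_d).

(** The element [t0] keeps the index type nonempty, since an empty average would be 0 and violate
    any nonzero trace condition. Rational weights are obtained by repeating terms. *)
Definition avg_closed (S : op -> Prop) : Prop :=
  forall (T : finType) (t0 : T) (X : T -> op),
    (forall t, S (X t)) -> S (#|T|%:R^-1 *: \sum_t X t).

(** Averages X over the cyclic group generated by u, which need only have finite order on X. The
    last clause lets symmetries of the whole orbit of X survive the averaging. *)
Lemma avg_cyclic (S : op -> Prop) u n X :
  avg_closed S -> (forall Z, S Z -> S (tw u Z)) -> S X ->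
  iter n.+1 (tw u) X = X ->
  exists Y, [/\ S Y, tw u Y = Y &
    forall v, (forall t, tw v (iter t (tw u) X) = iter t (tw u) X) -> tw v Y = Y].
Proof.
move=> avgS Su SX ord_u.
exists (#|'I_n.+1|%:R^-1 *: \sum_(t < n.+1) iter t (tw u) X); split.
- apply: avgS; first exact: ord0.
  by move=> t; elim: (t : nat) => //= k; apply: Su.
- rewrite linearZ linear_sum /=; congr (_ *: _).
  rewrite big_ord_recr [RHS]big_ord_recl /= addrC; congr (_ + _).
  by rewrite -[LHS]/(iter n.+1 (tw u) X) ord_u.
- by move=> v vX; rewrite linearZ linear_sum; congr (_ *: _); apply: eq_bigr => t _; apply: vX.
Qed.

(** Averages over the elements of s one after the other. Commutativity keeps the symmetries under
    the elements already treated; the normalization hypothesis keeps the symmetries Q acquired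
    beforehand. *)
Lemma avg_seq (S Q : _ -> Prop) n (s : seq 'M[C]_d) X :
  avg_closed S -> (forall u, u \in s -> forall Z, S Z -> S (tw u Z)) ->
  (forall u, u \in s -> forall Z, iter n.+1 (tw u) Z = Z) ->
  {in s &, forall u v, u *m v = v *m u} ->
  (forall u v Z, u \in s -> Q v -> (forall w, Q w -> tw w Z = Z) ->
     tw v (tw u Z) = tw u Z) ->
  S X -> (forall v, Q v -> tw v X = X) ->
  exists Y, [/\ S Y, forall v, Q v -> tw v Y = Y & forall u, u \in s -> tw u Y = Y].
Proof.
move=> avgS; elim: s => [|u s IHs] Ss ord comm norm SX QX; first by exists X.
have us v : v \in s -> v \in u :: s by rewrite inE orbC => ->.
have [||||Y [SY QY sY]] := IHs _ _ _ _ SX QX.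
- by move=> v /us; apply: Ss.
- by move=> v /us; apply: ord.
- by move=> v w /us vs /us; apply: comm.
- by move=> v w Z /us; apply: norm.
have uu : u \in u :: s by rewrite inE eqxx.
have [Y' [SY' uY' inv]] := avg_cyclic avgS (Ss u uu) SY (ord u uu Y).
exists Y'; split=> // [v Qv|v].
  (* The induction carries all of Q at once, because moving one element of Q past u may turn it into
     a product of several others. *)
  apply: inv => t; suff iterQ : forall w, Q w ->
      tw w (iter t (tw u) Y) = iter t (tw u) Y by exact: iterQ.
  by elim: t => [|t IHt] w Qw /=; [apply: QY | apply: norm].
rewrite inE => /orP[/eqP->//|vs]; apply: inv.
elim=> [|t IHt] /=; first exact: sY.
by rewrite -twM (comm v u (us v vs) uu) twM IHt.
Qed.

(** The quaternion units i ([Zmx]) and j ([Jmx]) at the site x, with 1 at every other site; together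
    they generate a quaternion group at x. *)
Definition Zmx (x : 'I_m) : 'M[C]_d :=
  qmx (fun a => if a == x then 'i else 1) (fun=> 0).
Definition Jmx (x : 'I_m) : 'M[C]_d :=
  qmx (fun a => if a == x then 0 else 1) (fun a => (a == x)%:R).
(* The quaternion (1 + i + j + k) / 2 has order 3 up to sign, and conjugation by
   it permutes i, j, k cyclically. *)
Definition hurwitz_mx : 'M[C]_d := qmx (fun=> (1 + 'i) / 2) (fun=> (1 + 'i) / 2).

Definition twirled Y : Prop :=
  [/\ forall x, tw (Zmx x) Y = Y, forall x, tw (Jmx x) Y = Y,
      forall s, tw (pmx C s) Y = Y & tw hurwitz_mx Y = Y].

Lemma conj_half : ((1 + 'i) / 2 : C)^* = (1 - 'i) / 2.
Proof. by rewrite rmorphM rmorphD /= fmorphV rmorph_nat rmorph1 conjCi. Qed.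

Lemma Zmx_site_symp x : site_symp (Zmx x).
Proof.
apply: qmx_site_symp => a; rewrite rmorph0 mulr0 addr0; case: ifP => _.
  by rewrite conjCi mulrN -expr2 sqrCi opprK.
by rewrite rmorph1 mulr1.
Qed.

Lemma Jmx_site_symp x : site_symp (Jmx x).
Proof.
apply: qmx_site_symp => a; rewrite rmorph_nat; case: ifP => _.
  by rewrite mul0r add0r mulr1.
by rewrite rmorph1 mulr0 mulr1 addr0.
Qed.

Lemma hurwitz_site_symp : site_symp hurwitz_mx.
Proof.
apply: qmx_site_symp => a; rewrite conj_half.
have i2 : 'i * 'i = -1 :> C by rewrite -expr2 sqrCi.
have -> : (1 + 'i) / 2 * ((1 - 'i) / 2) = (1 - 'i * 'i) / 4 :> C by field.
by rewrite i2; field.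
Qed.

Lemma i_sqr : 'i ^+ 2 = -1 :> C. Proof. exact: sqrCi. Qed.

Lemma iter_tw u n Z : iter n (tw u) Z = tw (iter n (mulmx u) 1%:M) Z.
Proof. by elim: n => /= [|n IHn]; rewrite ?tw1 // twM IHn. Qed.

Lemma iter_Zmx x Z : iter 4 (tw (Zmx x)) Z = Z.
Proof.
rewrite iter_tw /= mulmx1 -[RHS]tw1; congr tw; rewrite -qmx1 !qmx_mul.
by apply: eq_qmx => a; case: (a == x); conj_simp; ring: i_sqr.
Qed.

Lemma iter_Jmx x Z : iter 4 (tw (Jmx x)) Z = Z.
Proof.
rewrite iter_tw /= mulmx1 -[RHS]tw1; congr tw; rewrite -qmx1 !qmx_mul.
by apply: eq_qmx => a; case: (a == x); conj_simp; ring.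
Qed.

Lemma iter_hurwitz Z : iter 3 (tw hurwitz_mx) Z = Z.
Proof.
rewrite iter_tw /= mulmx1 -[RHS]tw1 -[RHS]twN; congr tw; rewrite -qmx1 qmx_opp.
by rewrite !qmx_mul; apply: eq_qmx => a; conj_simp; field: i_sqr.
Qed.

Lemma Zmx_comm x y : Zmx x *m Zmx y = Zmx y *m Zmx x.
Proof. by rewrite !qmx_mul; apply: eq_qmx => a; conj_simp; ring. Qed.

Lemma Jmx_comm x y : Jmx x *m Jmx y = Jmx y *m Jmx x.
Proof.
rewrite !qmx_mul; apply: eq_qmx => a; first by conj_simp; ring.
by case: (a == x); case: (a == y); conj_simp; ring.
Qed.

(** At a common site i j = j i^3, and at distinct sites the two matrices commute. Hence invariance
    under all [Zmx x] survives the average over the [Jmx y]. *)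
Lemma Zmx_Jmx x y : exists n, Zmx x *m Jmx y = Jmx y *m iter n (mulmx (Zmx x)) 1%:M.
Proof.
case: (eqVneq x y) => [<-|xy]; [exists 3%N | exists 1%N]; rewrite /= mulmx1 !qmx_mul.
  by apply: eq_qmx => a; case: (a == x); conj_simp; ring: i_sqr.
by apply: eq_qmx => a; have := xy; case: (eqVneq a x) => [->|_];
  case: (eqVneq _ y) => //= *; conj_simp; ring.
Qed.

(** With h the global quaternion, i h = h (i j) and, in the next lemma, j h = h i: so h normalizes
    the group generated by the units at all sites. *)
Lemma Zmx_hurwitz x : Zmx x *m hurwitz_mx = hurwitz_mx *m (Zmx x *m Jmx x).
Proof.
by rewrite !qmx_mul; apply: eq_qmx => a; case: (a == x); conj_simp; field: i_sqr.
Qed.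

Lemma Jmx_hurwitz x : Jmx x *m hurwitz_mx = hurwitz_mx *m Zmx x.
Proof.
by rewrite !qmx_mul; apply: eq_qmx => a; case: (a == x); conj_simp; field: i_sqr.
Qed.

Lemma pmx_Zmx s x : Zmx x *m pmx C s = pmx C s *m Zmx (s^-1%g x).
Proof.
rewrite pmx_qmx; congr (_ *m _); apply: eq_qmx => a //.
by rewrite (inj_eq perm_inj).
Qed.

Lemma pmx_Jmx s x : Jmx x *m pmx C s = pmx C s *m Jmx (s^-1%g x).
Proof.
by rewrite pmx_qmx; congr (_ *m _); apply: eq_qmx => a; rewrite (inj_eq perm_inj).
Qed.

(** The order of the averages matters: first the commuting [Zmx], then the [Jmx], then the site
    permutations, and finally h. Each new element normalizes the group treated before it, so no
    symmetry is lost. *)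
Lemma exists_twirled (S : op -> Prop) X : avg_closed S ->
  (forall U Z, site_symp U -> S Z -> S (tw U Z)) -> S X ->
  exists2 Y, S Y & twirled Y.
Proof.
move=> avgS Ss SX.
have [||||||Y1 [SY1 _ ZY1]] := @avg_seq S (fun=> False) 3 (codom Zmx) X avgS => //.
- by move=> _ /codomP[x ->] Z; apply/Ss/Zmx_site_symp.
- by move=> _ /codomP[x ->] Z; apply: iter_Zmx.
- by move=> _ _ /codomP[x ->] /codomP[y ->]; apply: Zmx_comm.
have [||||||Y2 [SY2 ZY2 JY2]] :=
  @avg_seq S (fun u => u \in codom Zmx) 3 (codom Jmx) Y1 avgS => //.
- by move=> _ /codomP[x ->] Z; apply/Ss/Jmx_site_symp.
- by move=> _ /codomP[x ->] Z; apply: iter_Jmx.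
- by move=> _ _ /codomP[x ->] /codomP[y ->]; apply: Jmx_comm.
- move=> _ _ Z /codomP[y ->] /codomP[x ->] ZZ; have [n ZJ] := Zmx_Jmx x y.
  rewrite -twM ZJ twM -iter_tw; congr tw; elim: n {ZJ} => //= n ->.
  exact/ZZ/codom_f.
(* The site permutations do not commute with each other, so they are averaged over the whole
   symmetric group at once. *)
pose Y3 := #|{: 'S_m}|%:R^-1 *: \sum_(s : 'S_m) tw (pmx C s) Y2.
have SY3 : S Y3 by apply: avgS => [|s]; [exact: 1%g | apply/Ss/SY2/pmx_site_symp].
have PY3 s : tw (pmx C s) Y3 = Y3.
  rewrite /Y3 linearZ linear_sum [in RHS](reindex_inj (mulIg s)) /=; congr (_ *: _).
  by apply: eq_bigr => t _; rewrite -twM pmx_mul.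
have ZY3 x : tw (Zmx x) Y3 = Y3.
  rewrite /Y3 linearZ linear_sum /=; congr (_ *: _); apply: eq_bigr => s _.
  by rewrite -twM pmx_Zmx twM ZY2 // codom_f.
have JY3 x : tw (Jmx x) Y3 = Y3.
  rewrite /Y3 linearZ linear_sum /=; congr (_ *: _); apply: eq_bigr => s _.
  by rewrite -twM pmx_Jmx twM JY2 // codom_f.
pose Q u := [\/ u \in codom Zmx, u \in codom Jmx | u \in codom (@pmx C m)].
have [||||||Y4 [SY4 QY4 hY4]] := @avg_seq S Q 2 [:: hurwitz_mx] Y3 avgS => //.
- by move=> u; rewrite inE => /eqP-> Z; apply/Ss/hurwitz_site_symp.
- by move=> u; rewrite inE => /eqP-> Z; apply: iter_hurwitz.
- by move=> u v; rewrite !inE => /eqP-> /eqP->.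
- move=> _ v Z /[!inE] /eqP-> Qv QZ.
  have QZZ x : tw (Zmx x) Z = Z by apply: QZ; constructor 1; apply: codom_f.
  have QJZ x : tw (Jmx x) Z = Z by apply: QZ; constructor 2; apply: codom_f.
  have QpZ x : tw (pmx C x) Z = Z by apply: QZ; constructor 3; apply: codom_f.
  case: Qv => /codomP[x ->]; rewrite -twM.
  + by rewrite Zmx_hurwitz !twM QJZ QZZ.
  + by rewrite Jmx_hurwitz !twM QZZ.
  + by rewrite pmx_qmx -/hurwitz_mx twM QpZ.
- by move=> v [] /codomP[x ->].
exists Y4 => //; split=> [x|x|s|].
- by apply: QY4; constructor 1; apply: codom_f.
- by apply: QY4; constructor 2; apply: codom_f.
- by apply: QY4; constructor 3; apply: codom_f.
- by apply: hY4; rewrite inE.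
Qed.

End Averaging.

(** * Action of the generators on matrix entries *)

Section Commutant.
Variables (C : numClosedFieldType) (m : nat).
Local Notation d := (m + m)%N.
Local Notation op := 'M[C]_(d * d).
Implicit Types (Y : op) (s t u v : bool) (a b c e x : 'I_m).

Lemma sum_bmx (w : 'I_m -> bool -> bool -> C) s a (F : 'I_d -> C) :
  \sum_i bmx w (idx s a) i * F i = \sum_(s' : bool) w a s s' * F (idx s' a).
Proof.
rewrite sum_idx (bigD1 a) //= big1 ?addr0 => [|b /negPf ab].
  by rewrite big_bool !bmxE eqxx !mul1r addrC.
by rewrite !bmxE eq_sym ab !mul0r addr0.
Qed.

Lemma sum_bmx_conj (w : 'I_m -> bool -> bool -> C) s a (F : 'I_d -> C) :
  \sum_i (bmx w (idx s a) i)^* * F i = \sum_(s' : bool) (w a s s')^* * F (idx s' a).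
Proof.
rewrite -(sum_bmx (fun a s t => (w a s t)^*)); apply: eq_bigr => i _.
by rewrite !mxE rmorphM rmorph_nat.
Qed.

Lemma ent_tw_bmx w Y s a t b u c v e :
  ent (tw (bmx w) Y) (idx s a) (idx t b) (idx u c) (idx v e) =
  \sum_(s' : bool) w a s s' * \sum_(t' : bool) (w b t t')^* *
  \sum_(u' : bool) (w c u u')^* * \sum_(v' : bool) w e v v' *
    ent Y (idx s' a) (idx t' b) (idx u' c) (idx v' e).
Proof.
rewrite entE_tw; transitivity (\sum_i bmx w (idx s a) i *
  \sum_j (bmx w (idx t b) j)^* * \sum_k (bmx w (idx u c) k)^* *
  \sum_l bmx w (idx v e) l * ent Y i j k l).
  apply: eq_bigr => i _; rewrite big_distrr; apply: eq_bigr => j _.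
  rewrite !big_distrr; apply: eq_bigr => k _; rewrite !big_distrr.
  by apply: eq_bigr => l _ /=; ring.
rewrite sum_bmx; apply: eq_bigr => s' _; congr (_ * _).
rewrite sum_bmx_conj; apply: eq_bigr => t' _; congr (_ * _).
rewrite sum_bmx_conj; apply: eq_bigr => u' _; congr (_ * _).
exact: sum_bmx.
Qed.

(** [phase] is the eigenvalue of [Zmx x] on the basis vector with spin s and site a. [flip_sgn] is
    the only nonzero entry in the corresponding row of [Jmx x], which flips the spin when a = x. *)
Definition phase x s a : C := if a == x then (if s then - 'i else 'i) else 1.
Definition flip_sgn x s a : C := if (a == x) && s then -1 else 1.

Lemma sum_Zmx x s a (F : bool -> C) :
  \sum_(s' : bool) quat (if a == x then 'i else 1) 0 s s' * F s' =
  phase x s a * F s.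
Proof.
by rewrite big_bool /phase; case: s; case: (a == x); conj_simp; ring.
Qed.

Lemma sum_Zmx_conj x s a (F : bool -> C) :
  \sum_(s' : bool) (quat (if a == x then 'i else 1) 0 s s')^* * F s' =
  (phase x s a)^* * F s.
Proof.
by rewrite big_bool /phase; case: s; case: (a == x); conj_simp; ring.
Qed.

Lemma sum_Jmx x s a (F : bool -> C) :
  \sum_(s' : bool) quat (if a == x then 0 else 1) (a == x)%:R s s' * F s' =
  flip_sgn x s a * F (s (+) (a == x)).
Proof.
by rewrite big_bool /flip_sgn; case: s; case: (a == x); conj_simp; ring.
Qed.

Lemma sum_Jmx_conj x s a (F : bool -> C) :
  \sum_(s' : bool) (quat (if a == x then 0 else 1) (a == x)%:R s s')^* * F s' =
  flip_sgn x s a * F (s (+) (a == x)).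
Proof.
by rewrite big_bool /flip_sgn; case: s; case: (a == x); conj_simp; ring.
Qed.

Lemma ent_Zmx Y x s a t b u c v e : tw (Zmx C x) Y = Y ->
  ent Y (idx s a) (idx t b) (idx u c) (idx v e) =
  phase x s a * ((phase x t b)^* * ((phase x u c)^* * (phase x v e *
    ent Y (idx s a) (idx t b) (idx u c) (idx v e)))).
Proof.
move=> {1}<-; rewrite ent_tw_bmx sum_Zmx; congr (_ * _).
by rewrite sum_Zmx_conj sum_Zmx_conj sum_Zmx.
Qed.

Lemma ent_Jmx Y x s a t b u c v e : tw (Jmx C x) Y = Y ->
  ent Y (idx s a) (idx t b) (idx u c) (idx v e) =
  flip_sgn x s a * (flip_sgn x t b * (flip_sgn x u c * (flip_sgn x v e *
    ent Y (idx (s (+) (a == x)) a) (idx (t (+) (b == x)) b)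
          (idx (u (+) (c == x)) c) (idx (v (+) (e == x)) e)))).
Proof.
move=> {1}<-; rewrite ent_tw_bmx sum_Jmx; congr (_ * _).
by rewrite sum_Jmx_conj sum_Jmx_conj sum_Jmx.
Qed.

Lemma sum_pmx (sg : 'S_m) s a (F : 'I_d -> C) :
  \sum_i pmx C sg (idx s (sg a)) i * F i = F (idx s a).
Proof.
rewrite (bigD1 (idx s a)) //= big1 ?addr0 => [|i].
  by rewrite pmxE !eqxx mul1r.
elim/idxP: i => t b; rewrite idx_eq eq_sym [b == a]eq_sym => /negPf.
by rewrite pmxE (inj_eq perm_inj) => ->; rewrite mul0r.
Qed.

Lemma pmx_conj (sg : 'S_m) i j : (pmx C sg i j)^* = pmx C sg i j.
Proof. by rewrite mxE rmorph_nat. Qed.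

Lemma ent_pmx Y (sg : 'S_m) s a t b u c v e : tw (pmx C sg) Y = Y ->
  ent Y (idx s (sg a)) (idx t (sg b)) (idx u (sg c)) (idx v (sg e)) =
  ent Y (idx s a) (idx t b) (idx u c) (idx v e).
Proof.
move=> {1}<-; rewrite entE_tw.
transitivity (\sum_i pmx C sg (idx s (sg a)) i *
  \sum_j pmx C sg (idx t (sg b)) j * \sum_k pmx C sg (idx u (sg c)) k *
  \sum_l pmx C sg (idx v (sg e)) l * ent Y i j k l); last by rewrite !sum_pmx.
apply: eq_bigr => i _; rewrite big_distrr; apply: eq_bigr => j _.
rewrite !big_distrr; apply: eq_bigr => k _; rewrite !big_distrr.
by apply: eq_bigr => l _ /=; rewrite !pmx_conj; ring.
Qed.

Lemma two_transitive a0 b0 a b : a0 != b0 -> a != b ->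
  exists sg : 'S_m, sg a0 = a /\ sg b0 = b.
Proof.
move=> ab0 ab; exists (tperm b0 (tperm a0 a b) * tperm a0 a)%g.
have b_a : a0 != tperm a0 a b.
  by rewrite -(inj_eq (@perm_inj _ (tperm a0 a))) tpermK tpermL.
split; rewrite permM; last by rewrite tpermL tpermK.
by rewrite (tpermD _ (_ : _ != a0)) ?tpermL // eq_sym.
Qed.

Lemma phase_out x s a : a != x -> phase x s a = 1.
Proof. by rewrite /phase => /negPf->. Qed.

Lemma mul_phase_eq0 x s (z : C) :
  z = phase x s x * z \/ z = (phase x s x)^* * z -> z = 0.
Proof.
have i1 : 'i != 1 :> C.
  apply/eqP => /(congr1 (fun z => z ^+ 2)); rewrite sqrCi expr1n => /eqP.
  by rewrite eqNr oner_eq0.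
have i2 : - 'i != 1 :> C.
  apply/eqP => /(congr1 (fun z => z ^+ 2)); rewrite sqrrN sqrCi expr1n => /eqP.
  by rewrite eqNr oner_eq0.
have cancel1 (w : C) : w != 1 -> z = w * z -> z = 0.
  move=> w1 /eqP; rewrite -subr_eq0 -{1}[z]mul1r -mulrBl mulf_eq0 subr_eq0 eq_sym.
  by rewrite (negPf w1) => /eqP.
rewrite /phase eqxx; case: s => -[]; apply: cancel1; conj_simp;
  by rewrite ?opprK.
Qed.

(** If the four sites do not match in pairs, one of them occurs exactly once; invariance under [Zmx]
    at that site multiplies the entry by i or -i. *)
Lemma ent_unpaired Y s a t b u c v e : (forall x, tw (Zmx C x) Y = Y) ->
  ~~ [|| (a == b) && (c == e), (a == c) && (b == e) | (a == e) && (b == c)] ->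
  ent Y (idx s a) (idx t b) (idx u c) (idx v e) = 0.
Proof.
move=> Z H.
have Zx x := @ent_Zmx Y x s a t b u c v e (Z x).
have [/and3P[h1 h2 h3]|[/and3P[h1 h2 h3]|[/and3P[h1 h2 h3]|/and3P[h1 h2 h3]]]] :
  [&& b != a, c != a & e != a] \/ [&& a != b, c != b & e != b] \/
  [&& a != c, b != c & e != c] \/ [&& a != e, b != e & c != e].
- move: H; case: (eqVneq a b) => [?|ab]; case: (eqVneq a c) => [?|ac];
    case: (eqVneq a e) => [?|ae]; subst; rewrite ?eqxx ?orbT ?orbF ?andbF ?andbT //= => H.
  + by do 3!right; rewrite ae.
  + by do 2!right; left; rewrite ac.
  + by do 2!right; left; rewrite ac eq_sym H.
  + by right; left; rewrite ab.
  + by right; left; rewrite ab eq_sym H.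
  + by right; left; rewrite ab eq_sym H.
  + by left.
- by move: (Zx a); rewrite !(phase_out _ h1, phase_out _ h2, phase_out _ h3)
    ?rmorph1 ?mul1r => E; apply: (@mul_phase_eq0 a s); left.
- by move: (Zx b); rewrite !(phase_out _ h1, phase_out _ h2, phase_out _ h3)
    ?rmorph1 ?mul1r => E; apply: (@mul_phase_eq0 b t); right.
- by move: (Zx c); rewrite !(phase_out _ h1, phase_out _ h2, phase_out _ h3)
    ?rmorph1 ?mul1r => E; apply: (@mul_phase_eq0 c u); right.
- by move: (Zx e); rewrite !(phase_out _ h1, phase_out _ h2, phase_out _ h3)
    ?rmorph1 ?mul1r => E; apply: (@mul_phase_eq0 e v); left.
Qed.


(** * Entries of an operator fixed by the finite group *)

Section TwirledEntries.
Variables (Y : op) (tY : twirled Y).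
Let Z : forall x, tw (Zmx C x) Y = Y. Proof. by case: tY. Qed.
Let J : forall x, tw (Jmx C x) Y = Y. Proof. by case: tY. Qed.
Let P : forall sg, tw (pmx C sg) Y = Y. Proof. by case: tY. Qed.
Let H : tw (hurwitz_mx C m) Y = Y. Proof. by case: tY. Qed.

Lemma eqN_eq0 (w : C) : w = - w -> w = 0.
Proof.
move=> /eqP; rewrite -subr_eq0 opprK -mulr2n mulrn_eq0 => /eqP //.
Qed.

Lemma i_mul : 'i * 'i = -1 :> C. Proof. by rewrite -expr2 sqrCi. Qed.

(** The two indices at site a carry conjugate phases, so different spins there give a factor -1 and
    the entry vanishes; likewise at b. Invariance under [Jmx] at a and at b then makes the remaining
    entries independent of the spins. The next lemma follows the same pattern. *)
Lemma ent_pair_id a b s t u v : a != b ->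
  ent Y (idx s a) (idx t b) (idx u a) (idx v b) =
  ((s == u) && (t == v))%:R *
  ent Y (idx false a) (idx false b) (idx false a) (idx false b).
Proof.
move=> ab; have ba : (b == a) = false by rewrite eq_sym (negPf ab).
have za := ent_Zmx s a t b u a v b (Z a).
have zb := ent_Zmx s a t b u a v b (Z b).
have ja := ent_Jmx s a t b s a t b (J a).
have jb := ent_Jmx false a t b false a t b (J b).
move: za zb ja jb; rewrite /phase /flip_sgn !eqxx (negPf ab) ba /= !addbF => za zb ja jb.
case: (eqVneq s u) => [?|su] /=; [subst u | ]; last first.
  rewrite mul0r; apply: eqN_eq0; rewrite {1}za; move: su.
  by case: (s); case: (u) => // _; conj_simp; ring: i_mul.
case: (eqVneq t v) => [?|tv] /=; [subst v | ]; last first.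
  rewrite mul0r; apply: eqN_eq0; rewrite {1}zb; move: tv.
  by case: (t); case: (v) => // _; conj_simp; ring: i_mul.
have -> : ent Y (idx s a) (idx t b) (idx s a) (idx t b) =
          ent Y (idx false a) (idx t b) (idx false a) (idx t b).
  by case: s {za zb} ja => // ->; rewrite /=; ring.
by case: t jb {zb za ja} => [->|_]; rewrite /=; ring.
Qed.

Lemma ent_pair_bell a b s t u v : a != b ->
  ent Y (idx s a) (idx t a) (idx u b) (idx v b) =
  ((s == t) && (u == v))%:R *
  ent Y (idx false a) (idx false a) (idx false b) (idx false b).
Proof.
move=> ab; have ba : (b == a) = false by rewrite eq_sym (negPf ab).
have za := ent_Zmx s a t a u b v b (Z a).
have zb := ent_Zmx s a t a u b v b (Z b).
have ja := ent_Jmx s a s a u b u b (J a).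
have jb := ent_Jmx false a false a u b u b (J b).
move: za zb ja jb; rewrite /phase /flip_sgn !eqxx (negPf ab) ba /= !addbF => za zb ja jb.
case: (eqVneq s t) => [?|st] /=; [subst t | ]; last first.
  rewrite mul0r; apply: eqN_eq0; rewrite {1}za; move: st.
  by case: (s); case: (t) => // _; conj_simp; ring: i_mul.
case: (eqVneq u v) => [?|uv] /=; [subst v | ]; last first.
  rewrite mul0r; apply: eqN_eq0; rewrite {1}zb; move: uv.
  by case: (u); case: (v) => // _; conj_simp; ring: i_mul.
have -> : ent Y (idx s a) (idx s a) (idx u b) (idx u b) =
          ent Y (idx false a) (idx false a) (idx u b) (idx u b).
  by case: s {za zb} ja => // ->; rewrite /=; ring.
by case: u jb {zb za ja} => [->|_]; rewrite /=; ring.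
Qed.

(** Here the two phases at a site are both conjugated or both not, so it is equal spins that give
    -1. The entries with opposite spins are related by [Jmx], whose signs combine into [sgn2]. *)
Lemma ent_pair_flip a b s t u v : a != b ->
  ent Y (idx s a) (idx t b) (idx u b) (idx v a) =
  sgn2 C t u * sgn2 C v s *
  ent Y (idx true a) (idx false b) (idx true b) (idx false a).
Proof.
move=> ab; have ba : (b == a) = false by rewrite eq_sym (negPf ab).
have za := ent_Zmx s a t b u b v a (Z a).
have zb := ent_Zmx s a t b u b v a (Z b).
have ja := ent_Jmx false a t b u b true a (J a).
have jb := ent_Jmx true a true b false b false a (J b).
move: za zb ja jb; rewrite /phase /flip_sgn !eqxx (negPf ab) ba /= !addbF => za zb ja jb.
rewrite /sgn2; case: (eqVneq v s) => [?|vs] /=; [subst v|].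
  rewrite mulr0 mul0r; apply: eqN_eq0; rewrite {1}za.
  by case: (s); conj_simp; ring: i_mul.
case: (eqVneq t u) => [?|tu] /=; [subst u|].
  rewrite !mul0r; apply: eqN_eq0; rewrite {1}zb.
  by case: (t); conj_simp; ring: i_mul.
have -> : ent Y (idx s a) (idx t b) (idx u b) (idx v a) = (if v then -1 else 1) *
          ent Y (idx true a) (idx t b) (idx u b) (idx false a).
  by case: s vs {za zb} => //; case: v => //= _; rewrite ?ja; ring.
by case: t tu jb {zb za ja} => //; case: u => //= _ E; rewrite ?E; ring.
Qed.

Definition site_ent a s t u v := ent Y (idx s a) (idx t a) (idx u a) (idx v a).

Lemma site_ent_odd a s t u v : s (+) t (+) u (+) v -> site_ent a s t u v = 0.
Proof.
move=> odd; apply: eqN_eq0.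
have := ent_Zmx s a t a u a v a (Z a); rewrite /phase !eqxx -/(site_ent _ _ _ _ _).
move=> {1}->; case: s odd; case: t; case: u; case: v => //= _;
  by conj_simp; ring: i_mul.
Qed.

Lemma site_ent_flip a s t u v : ~~ (s (+) t (+) u (+) v) ->
  site_ent a s t u v = site_ent a (~~ s) (~~ t) (~~ u) (~~ v).
Proof.
have := ent_Jmx s a t a u a v a (J a).
rewrite /flip_sgn !eqxx !addbT -!/(site_ent _ _ _ _ _) => {1}->.
by case: s; case: t; case: u; case: v => //= _; ring.
Qed.

(** Up to the parity and flip rules a site has four entries p, q, r, t. Invariance under the
    quaternion of order 3 gives 2p = p + q + r + t and 2t = q + r - p - t, whence t = 0 and p = q +
    r. *)
Lemma site_ent_hurwitz a :
  site_ent a false true true false = 0 /\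
  site_ent a false false false false =
    site_ent a false false true true + site_ent a false true false true.
Proof.
(* The right-hand side, left to unification, is the sixteen-term expansion of the twirled entry. *)
have h s t u v : site_ent a s t u v = _ :> C :=
  esym (etrans (esym (ent_tw_bmx _ Y s a t a u a v a)) (congr1 (fun Y => ent Y _ _ _ _) H)).
have h0 := h false false false false; have h1 := h false true true false.
move: h0 h1; rewrite !big_bool -!/(site_ent _ _ _ _ _).
rewrite !(@site_ent_odd a true true true false) // !(@site_ent_odd a true true false true) //.
rewrite !(@site_ent_odd a true false true true) // !(@site_ent_odd a false true true true) //.
rewrite !(@site_ent_odd a false false false true) // !(@site_ent_odd a false false true false) //.
rewrite !(@site_ent_odd a false true false false) // !(@site_ent_odd a true false false false) //.
rewrite !(@site_ent_flip a true true true true) // !(@site_ent_flip a true false true false) //.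
rewrite !(@site_ent_flip a true true false false) // !(@site_ent_flip a true false false true) //.
conj_simp; set p := site_ent a false false false false.
set q := site_ent a false false true true; set r := site_ent a false true false true.
set t := site_ent a false true true false => h0 h1.
have e0 : p * 2 = p + q + r + t by rewrite {1}h0; field: (i_sqr C).
have e1 : t * 2 = q + r - p - t by rewrite {1}h1; field: (i_sqr C).
have pE : p = q + r + t by rewrite -[p](addrK p) -mulr2n -mulr_natr e0; ring.
have t0 : t = 0.
  have /eqP : t * 4%:R = 0.
    have -> : t * 4%:R = t * 2 + t * 2 by ring.
    by rewrite {1}e1 pE; ring.
  by rewrite mulf_eq0 pnatr_eq0 orbF => /eqP.
by split=> //; rewrite pE t0 addr0.
Qed.

Lemma ent_perm1 a a0 s t u v : site_ent a s t u v = site_ent a0 s t u v.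
Proof.
by rewrite /site_ent -(ent_pmx s a0 t a0 u a0 v a0 (P (tperm a0 a))) !tpermL.
Qed.

Lemma twirled_ent (a0 b0 : 'I_m) : a0 != b0 ->
  exists al be ga de ep : C, forall s a t b u c v e,
  ent Y (idx s a) (idx t b) (idx u c) (idx v e) =
    al * ([&& s == u, a == c, t == v & b == e])%:R
  + be * ([&& s == t, a == b, u == v & c == e])%:R
  + ga * (((b == c) && (a == e))%:R * (sgn2 C t u * sgn2 C v s))
  + de * ([&& s == t, a == b, u == v, c == e & a == c])%:R
  + ep * ([&& s == u, a == c, t == v, b == e & a == b])%:R.
Proof.
move=> ab0.
pose al := ent Y (idx false a0) (idx false b0) (idx false a0) (idx false b0).
pose be := ent Y (idx false a0) (idx false a0) (idx false b0) (idx false b0).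
pose ga := ent Y (idx true a0) (idx false b0) (idx true b0) (idx false a0).
pose q := site_ent a0 false false true true.
pose r := site_ent a0 false true false true.
(* The last two coefficients correct the entries at a single site, where the first three terms
   already give be - ga in place of q and al + ga in place of r. *)
exists al, be, ga, (q - be + ga), (r - al - ga) => s a t b u c v e.
(* Site permutations are doubly transitive, so every pair of distinct sites reduces to the reference
   pair. *)
have pairE f a' b' : a' != b' -> (forall sg : 'S_m, f (sg a0) (sg b0) = f a0 b0) ->
    f a' b' = f a0 b0 :> C.
  by move=> ab inv; have [sg [<- <-]] := two_transitive ab0 ab; apply: inv.
have [|] := boolP [|| (a == b) && (c == e), (a == c) && (b == e) | (a == e) && (b == c)];
  last first.
  move=> unp; rewrite ent_unpaired //; move: unp; rewrite !negb_or.
  case: (a == b); case: (c == e); case: (a == c); case: (b == e); case: (a == e);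
    case: (b == c) => // _; rewrite /= ?andbF ?mul0r ?mulr0 ?addr0 //.
have same x s' t' u' v' : ent Y (idx s' x) (idx t' x) (idx u' x) (idx v' x) =
    al * ((s' == u') && (t' == v'))%:R + be * ((s' == t') && (u' == v'))%:R
    + ga * (sgn2 C t' u' * sgn2 C v' s')
    + (q - be + ga) * ((s' == t') && (u' == v'))%:R
    + (r - al - ga) * ((s' == u') && (t' == v'))%:R.
  rewrite -/(site_ent x s' t' u' v') (ent_perm1 x a0) /sgn2.
  have [odd|even] := boolP (s' (+) t' (+) u' (+) v').
    rewrite site_ent_odd //.
    by case: s' odd; case: t'; case: u'; case: v' => //= _; ring.
  have [t0 pE] := site_ent_hurwitz a0; case: s' even; last first.
    case: t'; case: u'; case: v' => //= _; rewrite ?t0 ?pE -/q -/r; ring.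
  case: t'; case: u'; case: v' => //= _; rewrite site_ent_flip //= ?t0 ?pE -/q -/r; ring.
case/or3P => /andP[/eqP ? /eqP ?]; subst.
- case: (eqVneq b e) => [?|be']; first subst b.
    by rewrite same ?eqxx /= ?andbT; ring.
  rewrite ent_pair_bell //.
  rewrite (@pairE (fun x y => ent Y (idx false x) (idx false x) (idx false y) (idx false y)) _ _ be') => [|sg]; last exact: ent_pmx.
  by rewrite -/be ?eqxx /= ?andbF ?andbT /=; ring.
- case: (eqVneq c e) => [?|ce]; first subst c.
    by rewrite same ?eqxx /= ?andbT; ring.
  rewrite ent_pair_id //.
  rewrite (@pairE (fun x y => ent Y (idx false x) (idx false y) (idx false x) (idx false y)) _ _ ce) => [|sg]; last exact: ent_pmx.
  by rewrite -/al ?eqxx /= ?andbF ?andbT /=; ring.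
- case: (eqVneq e c) => [?|ec]; first subst c.
    by rewrite same ?eqxx /= ?andbT; ring.
  rewrite ent_pair_flip //.
  rewrite (@pairE (fun x y => ent Y (idx true x) (idx false y) (idx true y) (idx false x)) _ _ ec) => [|sg]; last exact: ent_pmx.
  by rewrite -/ga ?eqxx /= ?andbF ?andbT /=; ring.
Qed.

End TwirledEntries.
End Commutant.

(** * The commutant of the finite group *)

Section Operators.
Variables (C : numClosedFieldType) (d : nat).
Implicit Types (A B M N U V : 'M[C]_d) (X Y : 'M[C]_(d * d)).

Lemma vecm_ext X Y : (forall M, X *m vecm M = Y *m vecm M) -> X = Y.
Proof.
move=> eqXY; apply/matrixP => p q.
have := eqXY (coef_mx (delta_mx q 0)); rewrite coef_mxK -!colE.
by move=> /matrixP/(_ p 0); rewrite !mxE.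
Qed.

Lemma ket2E (i j k l : 'I_d) (z : 'I_1) :
  ket2 C i j (mxtens_index (k, l)) z = ((k == i) && (l == j))%:R.
Proof.
by rewrite /ket2 !mxE !mxtens_indexK /= !ord1 !eqxx !andbT -natrM mulnb.
Qed.

Lemma ent_flip i j k l : ent (flip C d) i j k l = ((i == l) && (j == k))%:R.
Proof.
have E i' j' : (ket2 C i' j' *m (ket2 C j' i')^t*) (mxtens_index (i, j))
    (mxtens_index (k, l)) = [&& i == i', j == j', k == j' & l == i']%:R.
  rewrite mxE big_ord1 2![in X in _ * X]mxE !ket2E rmorph_nat -natrM mulnb.
  by rewrite -andbA.
rewrite /ent /flip summxE (bigD1 i) //= [X in _ + X]big1 ?addr0 => [|i' /negPf ii'].
  rewrite summxE (bigD1 j) //= big1 ?addr0 => [|j' /negPf jj'].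
    by rewrite E !eqxx /= [k == j]eq_sym [l == i]eq_sym andbC.
  by rewrite E [j == _]eq_sym jj' andbF.
by rewrite summxE big1 // => j' _; rewrite E [i == _]eq_sym ii'.
Qed.

Lemma flip_vecm M : flip C d *m vecm M = vecm M^T.
Proof.
apply/matrixP => p z; rewrite ord1; case: (mxtens_indexP p) => i j.
rewrite vecmE !mxE sum_pair (bigD1 j) //= [X in _ + X]big1 ?addr0 => [|k /negPf kj].
  rewrite (bigD1 i) //= big1 ?addr0 => [|l /negPf li].
    by rewrite vecmE -/(ent _ _ _ _ _) ent_flip !eqxx mul1r.
  by rewrite -/(ent _ _ _ _ _) ent_flip [_ == l]eq_sym li mul0r.
rewrite big1 // => l _.
by rewrite -/(ent _ _ _ _ _) ent_flip [_ == k]eq_sym kj andbF mul0r.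
Qed.

Lemma conjB_flip_vecm V M : conjB V (flip C d) *m vecm M = vecm (V *m M *m V^cj)^T.
Proof.
rewrite /conjB trmxC_tens trmx1 map_mx1 -!mulmxA tensmx_vecm mul1mx flip_vecm.
rewrite tensmx_vecm mul1mx -trmx_mul; congr (vecm (_ *m (_ *m _))^T).
by apply/matrixP => i j; rewrite !mxE.
Qed.

(** Conjugating the flip twisted by V replaces V by the congruent matrix A V A^T with A = conj U.
    This gives both the symplectic invariance of the twisted flip and the passage from V to
    [Omega]. *)
Lemma tw_conjB_flip U V :
  tw U (conjB V (flip C d)) = conjB (U^cj *m V *m U^t*) (flip C d).
Proof.
apply: vecm_ext => M; rewrite conjB_flip_vecm /tw trmxC_tens trmxC_conj.
rewrite -[LHS]mulmxA -[LHS]mulmxA tensmx_vecm conjB_flip_vecm tensmx_vecm.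
congr vecm; rewrite !map_mxM map_trmx !trmx_mul !trmxK.
have cK n k (A : 'M[C]_(n, k)) : A^cj^cj = A.
  by apply/matrixP => i j; rewrite !mxE conjCK.
by rewrite !map_trmx !cK !trmxK !mulmxA.
Qed.

Lemma tw_ketbra1 U : U \is unitarymx ->
  tw U (ketbra (vecm 1%:M)) = ketbra (vecm 1%:M).
Proof. by move=> /unitarymxP Uu; rewrite tw_ketbra mulmx1 Uu. Qed.

Lemma tw_id U : U \is unitarymx -> tw U 1%:M = 1%:M.
Proof.
move=> Uu; rewrite /tw mulmx1; apply: mulmx1C; exact: tw_unitary.
Qed.

Lemma tr_tens A B : \tr (A *t B) = \tr A * \tr B.
Proof.
rewrite /mxtrace sum_pair big_distrl; apply: eq_bigr => i _.
by rewrite big_distrr; apply: eq_bigr => j _; rewrite tensmxE.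
Qed.

Lemma tr_ketbra X M : \tr (ketbra (vecm M) *m X) = ((vecm M)^t* *m X *m vecm M) 0 0.
Proof.
by rewrite /ketbra -mulmxA mxtrace_mulC trace_mx11.
Qed.

Lemma tr_ketbra_tens A B M :
  \tr (ketbra (vecm M) *m (A *t B)) = \tr (M^t* *m A *m M *m B^T).
Proof.
by rewrite tr_ketbra -mulmxA tensmx_vecm dot_vecm mxE eqxx !mulmxA mulr1n.
Qed.

Lemma tr_ketbra2 M N :
  \tr (ketbra (vecm M) *m ketbra (vecm N)) = \tr (M^t* *m N) * \tr (N^t* *m M).
Proof.
rewrite tr_ketbra /ketbra mulmxA dot_vecm -mulmxA dot_vecm.
by rewrite mul_scalar_mx !mxE eqxx !mulr1n.
Qed.

Lemma tr_ketbra_flip V M :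
  \tr (ketbra (vecm M) *m conjB V (flip C d)) = \tr (M^t* *m (V *m M *m V^cj)^T).
Proof. by rewrite tr_ketbra -mulmxA conjB_flip_vecm dot_vecm mxE eqxx mulr1n. Qed.

Lemma tr_flip_tens A B : \tr (flip C d *m (A *t B)) = \tr (A *m B).
Proof.
rewrite {1}/mxtrace sum_pair [RHS]/mxtrace exchange_big /=; apply: eq_bigr => j _.
rewrite !mxE; apply: eq_bigr => i _.
rewrite mxE sum_pair (bigD1 j) //= [X in _ + X]big1 ?addr0 => [|k /negPf kj].
  rewrite (bigD1 i) //= big1 ?addr0 => [|l /negPf li].
    by rewrite tensmxE -/(ent _ _ _ _ _) ent_flip !eqxx mul1r.
  by rewrite -/(ent _ _ _ _ _) ent_flip [_ == l]eq_sym li mul0r.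
rewrite big1 // => l _.
by rewrite -/(ent _ _ _ _ _) ent_flip [_ == k]eq_sym kj andbF mul0r.
Qed.

Lemma conjB_tr V A B : \tr (conjB V (flip C d) *m (A *t B)) = \tr (A *m (V^t* *m B *m V)).
Proof.
rewrite /conjB trmxC_tens trmx1 map_mx1 -!mulmxA mxtrace_mulC -!mulmxA.
by rewrite !tensmx_mul !(mulmx1, mul1mx) tr_flip_tens.
Qed.

Lemma ent_ketbra (M : 'M[C]_d) i j k l :
  ent (ketbra (vecm M)) i j k l = M i j * (M k l)^*.
Proof. by rewrite /ent mxE big_ord1 2![in X in _ * X]mxE !vecmE. Qed.

Lemma ent_conjB_flip (V : 'M[C]_d) i j k l :
  ent (conjB V (flip C d)) i j k l = V j k * (V l i)^*.
Proof.
have -> : ent (conjB V (flip C d)) i j k l =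
          (conjB V (flip C d) *m vecm (delta_mx k l)) (mxtens_index (i, j)) 0.
  rewrite /ent [RHS]mxE (bigD1 (mxtens_index (k, l))) //= big1 ?addr0 => [|p pkl].
    by rewrite vecmE [delta_mx _ _ _ _]mxE !eqxx mulr1.
  case: (mxtens_indexP p) pkl => k' l'; rewrite (can_eq (@mxtens_indexK d d)).
  by rewrite vecmE [delta_mx _ _ _ _]mxE xpair_eqE => /negPf->; rewrite mulr0.
rewrite conjB_flip_vecm vecmE 2!mxE (bigD1 l) //= big1 ?addr0 => [|l' /negPf ll'].
  rewrite mxE (bigD1 k) //= big1 ?addr0 => [|k' /negPf kk'].
    by rewrite !mxE !eqxx mulr1.
  by rewrite !mxE kk' mulr0.
rewrite mxE big1 ?mul0r // => k' _.
by rewrite !mxE ll' andbF mulr0.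
Qed.

End Operators.

(** * The five invariant operators and their traces *)

Section SiteOperators.
Variables (C : numClosedFieldType) (m : nat).
Local Notation d := (m + m)%N.
Local Notation op := 'M[C]_(d * d).
Local Notation N := (d%:R : C).
Local Notation Om := (Omega C d).
Local Notation sitepr := (sitepr C).
Implicit Types (X Y : op) (U : 'M[C]_d) (x : 'I_m).

(** [Wop] is d times the maximally entangled projection and [Fop] the twisted flip. [D1op] and
    [D2op] sum over the sites the local versions of [Wop] and of the identity; the local version of
    [Fop] is their difference, by the identity for a product of two antisymmetric 2 x 2 symbols. *)
Definition Wop : op := ketbra (vecm 1%:M).
Definition Fop : op := conjB Om (flip C d).
Definition D1op : op := \sum_(x < m) ketbra (vecm (sitepr x)).
Definition D2op : op := \sum_(x < m) (sitepr x *t sitepr x).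

Lemma tr_bmx w : \tr (bmx w : 'M[C]_d) = \sum_a (w a false false + w a true true).
Proof.
by rewrite /mxtrace sum_idx; apply: eq_bigr => a _; rewrite !bmxE eqxx !mul1r.
Qed.

Lemma sitepr_trC x : (sitepr x)^t* = sitepr x.
Proof.
by rewrite bmx_trC; apply: eq_bmx => a s t; rewrite rmorph_nat [t == s]eq_sym.
Qed.

Lemma sitepr_tr x : (sitepr x)^T = sitepr x.
Proof. by rewrite bmx_tr; apply: eq_bmx => a s t; rewrite [t == s]eq_sym. Qed.

Lemma sitepr_cj x : (sitepr x)^cj = sitepr x.
Proof. by rewrite -{1}sitepr_tr sitepr_trC. Qed.

Lemma sitepr_mul x y : sitepr x *m sitepr y = (x == y)%:R *: sitepr x.
Proof.
rewrite bmx_mul; apply/matrixP => i j; rewrite !mxE.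
case: (eqVneq x y) => [<-|xy].
  by case: (site i == x); case: (spin i); case: (spin j); rewrite /=; ring.
case: (eqVneq (site i) x) => [->|_]; rewrite ?(negPf xy) /=; ring.
Qed.

Lemma tr_sitepr x : \tr (sitepr x) = 2.
Proof.
rewrite tr_bmx (bigD1 x) //= big1 ?addr0 => [|a /negPf ax]; last first.
  by rewrite ax addr0.
by rewrite eqxx /= -natrD.
Qed.

Lemma sum_sitepr : \sum_(x < m) sitepr x = 1%:M.
Proof.
rewrite bmx1; apply/matrixP; elim/idxP => s a; elim/idxP => t b.
rewrite summxE bmxE (bigD1 a) //= big1 ?addr0 => [|x /negPf xa].
  by rewrite bmxE eqxx.
by rewrite bmxE [a == x]eq_sym xa mulr0.
Qed.

Lemma Om_cj : Om^cj = Om.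
Proof. by apply/matrixP => i j; rewrite !mxE rmorphB /= !rmorph_nat. Qed.

Lemma Om_tr : Om^T = - Om.
Proof.
rewrite Omega_bmx bmx_tr bmx_opp; apply: eq_bmx => a s t.
by case: s; case: t; rewrite /sgn2 /= ?oppr0 ?opprK.
Qed.

Lemma Om_mul : Om *m Om = - 1%:M.
Proof.
rewrite Omega_bmx bmx_mul bmx1 bmx_opp; apply: eq_bmx => a s t.
by case: s; case: t; rewrite /sgn2 /=; ring.
Qed.

Lemma Om_trC : Om^t* = - Om.
Proof. by rewrite -map_trmx Om_cj Om_tr. Qed.

Lemma Om_sitepr x : Om *m sitepr x = sitepr x *m Om.
Proof.
rewrite Omega_bmx !bmx_mul; apply: eq_bmx => a s t.
by case: (a == x); case: s; case: t; rewrite /sgn2 /=; ring.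
Qed.

Lemma Fop_sqr : Fop *m Fop = 1%:M.
Proof.
apply: vecm_ext => M; rewrite -mulmxA !conjB_flip_vecm mul1mx Om_cj.
have trK (A : 'M[C]_d) : (Om *m A^T *m Om)^T = Om^T *m A *m Om^T.
  by rewrite !trmx_mul trmxK mulmxA.
rewrite trK Om_tr !mulNmx mulmxN opprK !mulmxA Om_mul.
by rewrite -mulmxA Om_mul mulNmx mulmxN mul1mx mulmx1 opprK.
Qed.

Lemma sumN (c : C) : \sum_(x < m) c = m%:R * c.
Proof. by rewrite sumr_const card_ord mulr_natl. Qed.

Lemma trW (A B : 'M[C]_d) : \tr (Wop *m (A *t B)) = \tr (A *m B^T).
Proof. by rewrite tr_ketbra_tens trmx1 map_mx1 mul1mx mulmx1. Qed.

(** The traces from here on form the Gram matrix of the five operators for the pairing tr(X Y), from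
    which the coefficients of an average are computed. *)
Lemma tr_I : \tr (1%:M : op) = N ^+ 2.
Proof. by rewrite -tens1mx1 tr_tens !mxtrace1 expr2. Qed.

Lemma tr_W : \tr Wop = N.
Proof. by rewrite -[Wop]mulmx1 -tens1mx1 trW trmx1 mulmx1 mxtrace1. Qed.

Lemma tr_F : \tr Fop = N.
Proof.
rewrite -[Fop]mulmx1 -tens1mx1 conjB_tr mul1mx mulmx1 Om_trC mulNmx Om_mul opprK.
by rewrite mxtrace1.
Qed.

Lemma tr_D1 : \tr D1op = N.
Proof.
rewrite raddf_sum /= -[RHS](mxtrace1 C d) -sum_sitepr raddf_sum; apply: eq_bigr => x _ /=.
rewrite -[ketbra _]mulmx1 -tens1mx1 tr_ketbra_tens trmx1 !mulmx1 sitepr_trC.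
by rewrite sitepr_mul eqxx scale1r.
Qed.

Lemma N2 : N = m%:R * 2. Proof. by rewrite natrD; ring. Qed.

Lemma tr_D2 : \tr D2op = 2 * N.
Proof.
rewrite raddf_sum /= N2; under eq_bigr do rewrite tr_tens tr_sitepr.
by rewrite sumN; ring.
Qed.

Lemma tr_WW : \tr (Wop *m Wop) = N ^+ 2.
Proof. by rewrite tr_ketbra2 trmx1 map_mx1 mulmx1 mxtrace1 expr2. Qed.

Lemma tr_WF : \tr (Wop *m Fop) = - N.
Proof.
rewrite tr_ketbra_flip mulmx1 Om_cj Om_mul trmx1 map_mx1 mul1mx mxtrace_tr.
by rewrite raddfN /= mxtrace1.
Qed.

Lemma tr_WD1 : \tr (Wop *m D1op) = 2 * N.
Proof.
rewrite mulmx_sumr raddf_sum /= N2.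
under eq_bigr do rewrite tr_ketbra2 trmx1 map_mx1 mul1mx mulmx1 sitepr_trC tr_sitepr.
by rewrite sumN; ring.
Qed.

Lemma tr_WD2 : \tr (Wop *m D2op) = N.
Proof.
rewrite mulmx_sumr raddf_sum /= N2.
under eq_bigr do rewrite trW sitepr_tr sitepr_mul eqxx scale1r tr_sitepr.
by rewrite sumN; ring.
Qed.

Lemma tr_FF : \tr (Fop *m Fop) = N ^+ 2.
Proof. by rewrite Fop_sqr tr_I. Qed.

Lemma tr_D1F : \tr (D1op *m Fop) = - N.
Proof.
rewrite mulmx_suml raddf_sum /= N2.
under eq_bigr => x _ do rewrite tr_ketbra_flip Om_cj Om_sitepr -mulmxA Om_mul
  mulmxN mulmx1 sitepr_trC raddfN /= sitepr_tr mulmxN raddfN /= sitepr_mul eqxx scale1r tr_sitepr.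
by rewrite sumN; ring.
Qed.

Lemma tr_FD2 : \tr (Fop *m D2op) = N.
Proof.
rewrite mulmx_sumr raddf_sum /= N2.
under eq_bigr => x _ do rewrite conjB_tr -mulmxA -Om_sitepr (mulmxA (Om^t*)) Om_trC
  mulNmx Om_mul opprK mul1mx sitepr_mul eqxx scale1r tr_sitepr.
by rewrite sumN; ring.
Qed.

Lemma tr_D1D1 : \tr (D1op *m D1op) = 2 * N.
Proof.
rewrite mulmx_suml raddf_sum /= N2.
rewrite (eq_bigr (fun=> 4)) => [|x _]; first by rewrite sumN; ring.
rewrite mulmx_sumr raddf_sum (bigD1 x) //= big1 ?addr0 => [|y /negPf yx].
  by rewrite tr_ketbra2 !sitepr_trC sitepr_mul eqxx scale1r tr_sitepr -natrM.
by rewrite tr_ketbra2 !sitepr_trC !sitepr_mul eq_sym yx !scale0r mxtrace0 mul0r.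
Qed.

Lemma tr_D1D2 : \tr (D1op *m D2op) = N.
Proof.
rewrite mulmx_suml raddf_sum /= N2.
rewrite (eq_bigr (fun=> 2)) => [|x _]; first by rewrite sumN; ring.
rewrite mulmx_sumr raddf_sum (bigD1 x) //= big1 ?addr0 => [|y /negPf yx].
  rewrite tr_ketbra_tens sitepr_trC sitepr_tr.
  by do 3!rewrite sitepr_mul eqxx scale1r; rewrite tr_sitepr.
rewrite tr_ketbra_tens sitepr_trC sitepr_tr sitepr_mul eq_sym yx scale0r !mul0mx.
by rewrite mxtrace0.
Qed.

Lemma tr_D2D2 : \tr (D2op *m D2op) = 2 * N.
Proof.
rewrite mulmx_suml raddf_sum /= N2.
rewrite (eq_bigr (fun=> 4)) => [|x _]; first by rewrite sumN; ring.
rewrite mulmx_sumr raddf_sum (bigD1 x) //= big1 ?addr0 => [|y /negPf yx].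
  by rewrite tensmx_mul tr_tens sitepr_mul eqxx scale1r tr_sitepr -natrM.
by rewrite tensmx_mul tr_tens sitepr_mul eq_sym yx scale0r mxtrace0 mul0r.
Qed.

Lemma twirled_span Y : (1 < m)%N -> twirled Y ->
  exists al be ga de ep : C,
    Y = al *: 1%:M + be *: Wop + ga *: Fop + de *: D1op + ep *: D2op.
Proof.
move=> m_gt1 tY.
pose a0 : 'I_m := Ordinal (ltnW m_gt1); pose b0 : 'I_m := Ordinal m_gt1.
have [al [be [ga [de [ep E]]]]] := twirled_ent tY (isT : a0 != b0).
exists al, be, ga, de, ep; apply: entP.
elim/idxP => s a; elim/idxP => t b; elim/idxP => u c; elim/idxP => v e.
have entD X X' i j k l : ent (X + X') i j k l = ent X i j k l + ent X' i j k l.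
  by rewrite /ent mxE.
have entZ z X i j k l : ent (z *: X) i j k l = z * ent X i j k l.
  by rewrite /ent mxE.
rewrite E !entD !entZ.
congr (_ * _ + _ * _ + _ * _ + _ * _ + _ * _).
- rewrite -tens1mx1 /ent tensmxE !mxE !idx_eq -natrM mulnb.
  by case: (s == u); case: (t == v); rewrite ?andbF.
- rewrite ent_ketbra !mxE !idx_eq rmorph_nat -natrM mulnb.
  by case: (s == t); case: (u == v); rewrite ?andbF.
- rewrite ent_conjB_flip Omega_bmx !bmxE rmorphM rmorph_nat [e == a]eq_sym /=.
  have -> : (sgn2 C v s)^* = sgn2 C v s by case: v; case: s; rewrite /sgn2 /= ?rmorphN ?rmorph1 ?rmorph0.
  by rewrite mulrACA -natrM mulnb.
- rewrite /ent summxE (bigD1 a) //= big1 ?addr0 => [|x /negPf xa].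
    rewrite -/(ent _ _ _ _ _) ent_ketbra !bmxE rmorphM !rmorph_nat eqxx.
    rewrite -!natrM !mulnb /= [c == a]eq_sym.
    by case: (s == t); case: (a == b); case: (c == e); case: (u == v); case: (a == c).
  by rewrite -/(ent _ _ _ _ _) ent_ketbra !bmxE [a == x]eq_sym xa mulr0 mul0r.
- rewrite /ent summxE (bigD1 a) //= big1 ?addr0 => [|x /negPf xa].
    rewrite tensmxE !bmxE eqxx -!natrM !mulnb /= [b == a]eq_sym.
    by case: (s == u); case: (a == c); case: (b == e); case: (t == v); case: (a == b).
  by rewrite tensmxE !bmxE [a == x]eq_sym xa mulr0 mul0r.
Qed.

End SiteOperators.

(** * The symplectic twirl *)

Section FlatUnitary.
Variable C : numClosedFieldType.

Lemma exists_unity_roots m : (0 < m)%N ->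
  exists r : m.-tuple C, uniq r /\ forall z, z \in (r : seq C) -> z ^+ m = 1.
Proof.
move=> m_gt0; have [r Dr] := closed_field_poly_normal ('X^m - 1 : {poly C}).
rewrite (monicP (monicXnsubC 1 m_gt0)) scale1r in Dr.
have sz_r : size r == m.
  by rewrite -eqSS -(size_prod_XsubC r id) -Dr size_XnsubC.
exists (Tuple sz_r); split=> [|z zr] /=.
  by rewrite -separable_prod_XsubC -Dr separable_Xn_sub_1 // pnatr_eq0 -lt0n.
have : root ('X^m - 1) z by rewrite Dr root_prod_XsubC.
by rewrite rootE !hornerE subr_eq0 => /eqP.
Qed.

(** The Fourier matrix: row i lists the powers of the i-th root of unity, divided by the square root
    of m. Distinct rows are orthogonal by the geometric sum. *)
Lemma exists_flat_unitary m : (0 < m)%N -> exists2 F : 'M[C]_m,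
  F \is unitarymx & forall i j, F i j * (F i j)^* = m%:R^-1.
Proof.
move=> m_gt0; have [r [uniq_r root_r]] := exists_unity_roots m_gt0.
have m0 : m%:R != 0 :> C by rewrite pnatr_eq0 -lt0n.
have rm i : tnth r i ^+ m = 1 by apply: root_r; apply: mem_tnth.
have norm_r i : tnth r i * (tnth r i)^* = 1.
  rewrite -normCK; have /eqP : `|tnth r i| ^+ m = 1 by rewrite -normrX rm normr1.
  by rewrite pexpr_eq1 // => /eqP->; rewrite expr1n.
pose s : C := (sqrtC m%:R)^-1.
have ss : s * s^* = m%:R^-1.
  have s_ge0 : 0 <= s by rewrite invr_ge0 sqrtC_ge0 ler0n.
  by rewrite (CrealP (ger0_real s_ge0)) -expr2 exprVn sqrtCK.
exists (\matrix_(i, j) (s * tnth r i ^+ j)) => [|i j]; last first.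
  by rewrite mxE rmorphM rmorphXn mulrACA ss -exprMn norm_r expr1n mulr1.
apply/unitarymxP/matrixP => i k; rewrite !mxE.
transitivity (m%:R^-1 * \sum_(j < m) (tnth r i * (tnth r k)^*) ^+ j).
  rewrite big_distrr; apply: eq_bigr => j _.
  by rewrite !mxE rmorphM rmorphXn mulrACA ss -exprMn.
case: (eqVneq i k) => [->|ik].
  under eq_bigr do rewrite norm_r expr1n.
  by rewrite sumr_const card_ord mulVf.
set w := tnth r i * (tnth r k)^*; have w1 : w != 1.
  apply: contraNneq ik => w1; have /eqP : tnth r i = tnth r k.
    by rewrite -[RHS]mul1r -w1 /w -mulrA [_^* * _]mulrC norm_r mulr1.
  by rewrite (inj_eq (tuple_uniqP _ uniq_r)).
have : (w - 1) * \sum_(j < m) w ^+ j = 0.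
  rewrite -subrX1 exprMn rm mul1r -rmorphXn /= rm rmorph1; exact: subrr.
move=> /eqP; rewrite mulf_eq0 subr_eq0 (negPf w1) /= => /eqP->.
by rewrite mulr0.
Qed.

End FlatUnitary.

(** * Invariance of the five operators, and the spreading unitary *)

Section SymplecticTwirl.
Variables (C : numClosedFieldType) (m : nat).
Local Notation d := (m + m)%N.
Local Notation op := 'M[C]_(d * d).
Local Notation N := (d%:R : C).
Local Notation Om := (Omega C d).
Local Notation sitepr := (sitepr C).
Local Notation Wop := (Wop C m).
Local Notation Fop := (Fop C m).
Local Notation D1op := (D1op C m).
Local Notation D2op := (D2op C m).
Implicit Types (X Y : op) (U : 'M[C]_d) (x : 'I_m).

Definition symplectic U : Prop := U \is unitarymx /\ U *m Om *m U^T = Om.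

Lemma site_symp_symplectic U : site_symp U -> symplectic U.
Proof. by case. Qed.

Lemma tw_W U : U \is unitarymx -> tw U Wop = Wop.
Proof. exact: tw_ketbra1. Qed.

Lemma tw_F U : symplectic U -> tw U Fop = Fop.
Proof.
move=> [Uu Us]; rewrite tw_conjB_flip; congr conjB.
by rewrite -{2}Om_cj -[in RHS]Us !map_mxM Om_cj -map_trmx.
Qed.

Lemma tw_D1 U : site_symp U -> tw U D1op = D1op.
Proof.
case=> _ _ [s Us]; rewrite linear_sum /=.
rewrite [RHS](reindex_inj (@perm_inj _ s)); apply: eq_bigr => x _.
by rewrite tw_ketbra Us.
Qed.

Lemma tw_D2 U : site_symp U -> tw U D2op = D2op.
Proof.
case=> _ _ [s Us]; rewrite linear_sum /=.
rewrite [RHS](reindex_inj (@perm_inj _ s)); apply: eq_bigr => x _.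
rewrite tw_tens Us; congr (_ *t _).
rewrite -[RHS]sitepr_cj -[in RHS]Us !map_mxM sitepr_cj; congr (_ *m _).
by apply/matrixP => i j; rewrite !mxE /= conjCK.
Qed.

Lemma tr_tw_inv U X Y : U \is unitarymx -> tw U Y = Y ->
  \tr (Y *m tw U X) = \tr (Y *m X).
Proof.
move=> Uu UY; rewrite twT // -{1}UY -twM.
by move/unitarymxP: Uu => /mulmx1C ->; rewrite tw1.
Qed.

Lemma avg_closed_tr Y (c : C) : avg_closed (fun X => \tr (Y *m X) = c).
Proof.
move=> T t0 X SX; have cT : #|T|%:R != 0 :> C.
  by rewrite pnatr_eq0 -lt0n; apply/card_gt0P; exists t0.
rewrite -scalemxAr mxtraceZ mulmx_sumr raddf_sum /=.
by under eq_bigr do rewrite SX; rewrite sumr_const -(mulr_natl c) mulKf.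
Qed.

Lemma tr_conj_eq0 n (A : 'M[C]_n) : \tr (A^t* *m A) = 0 -> A = 0.
Proof.
have nn (j i : 'I_n) : 0 <= A^t* j i * A i j.
  by rewrite !mxE mulrC mul_conjC_ge0.
move=> /eqP; rewrite /mxtrace psumr_eq0 => [/allP A0|j _]; last first.
  by rewrite mxE; apply: sumr_ge0.
apply/matrixP => i j; have := A0 j (mem_index_enum j).
rewrite mxE psumr_eq0 // => /allP/(_ i (mem_index_enum i)) /=.
by rewrite !mxE mulf_eq0 conjC_eq0 orbb => /eqP.
Qed.

Lemma W_herm : Wop^t* = Wop.
Proof. by rewrite trmxC_mul trmxCK. Qed.

Lemma F_herm : Fop^t* = Fop.
Proof.
apply: entP => i j k l; rewrite {1}/ent 2!mxE -/(ent _ _ _ _ _).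
by rewrite !ent_conjB_flip rmorphM /= conjCK mulrC.
Qed.

Lemma D1_herm : D1op^t* = D1op.
Proof.
rewrite linear_sum map_mx_sum; apply: eq_bigr => x _.
by rewrite trmxC_mul trmxCK.
Qed.

Lemma D2_herm : D2op^t* = D2op.
Proof.
rewrite linear_sum map_mx_sum; apply: eq_bigr => x _.
by rewrite trmxC_tens sitepr_trC.
Qed.

(** The five operators are Hermitian, so tr(X^* X) is a combination of the five traces, and X = 0 by
    definiteness. An element of the span is thus determined by its traces against the five
    operators. *)
Lemma twirled_eq0 X (al be ga de ep : C) :
  X = al *: 1%:M + be *: Wop + ga *: Fop + de *: D1op + ep *: D2op ->
  \tr X = 0 -> \tr (Wop *m X) = 0 -> \tr (Fop *m X) = 0 ->
  \tr (D1op *m X) = 0 -> \tr (D2op *m X) = 0 -> X = 0.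
Proof.
move=> E tI tW tF tD1 tD2; apply: tr_conj_eq0; rewrite {1}E.
rewrite !trmxCD !trmxCZ W_herm F_herm D1_herm D2_herm trmx1 map_mx1 !mulmxDl -!scalemxAl.
by rewrite !raddfD /= !mxtraceZ mul1mx tI tW tF tD1 tD2 !mulr0 !addr0.
Qed.


(** The matrix g = diag(F, conj F) preserves [Omega] because F F^* = 1. As the entries of F have
    constant modulus, g spreads each site evenly over all of them, and the two spins do not mix. *)
Lemma exists_spreading : (0 < m)%N -> exists2 g : 'M[C]_d, symplectic g &
  forall x y : 'I_m, sitepr y *m (g *m sitepr x *m g^t*) *m sitepr y =
    m%:R^-1 *: sitepr y.
Proof.
move=> m_gt0; have [F /unitarymxP Fu Fflat] := exists_flat_unitary C m_gt0.
have Fu' : F^cj *m F^T = 1%:M.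
  have -> : F^T = (F^t*)^cj by apply/matrixP => i j; rewrite !mxE /= conjCK.
  by rewrite -map_mxM Fu map_mx1.
pose g : 'M[C]_d := block_mx F 0 0 (F^cj).
have gtC : g^t* = block_mx (F^t*) 0 0 (F^T).
  rewrite tr_block_mx map_block_mx !trmx0 !map_mx0; congr block_mx.
  by apply/matrixP => i j; rewrite !mxE /= conjCK.
exists g.
  split; first by apply/unitarymxP; rewrite gtC mulmx_block !mulmx0 !mul0mx
    !addr0 !add0r Fu Fu' -scalar_mx_block.
  rewrite Omega_block tr_block_mx !mulmx_block !trmx0 map_trmx.
  by rewrite !(mulmx0, mul0mx, addr0, add0r, mulmx1, mulmxN, mulNmx) Fu Fu'.
pose f (s : bool) (a b : 'I_m) := if s then (F a b)^* else F a b.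
have gE s a t b : g (idx s a) (idx t b) = (s == t)%:R * f s a b.
  case: s; case: t; rewrite /g /idx ?block_mxEul ?block_mxEur ?block_mxEdl
    ?block_mxEdr ?mxE /= ?mul1r ?mul0r //.
have gCE s a t b : (g^t*) (idx s a) (idx t b) = (s == t)%:R * (f t b a)^*.
  by rewrite 2!mxE gE rmorphM rmorph_nat eq_sym.
have fflat s a b : f s a b * (f s a b)^* = m%:R^-1.
  by rewrite /f; case: s; rewrite ?conjCK ?[_^* * _]mulrC Fflat.
move=> x y; apply/matrixP; elim/idxP => s a; elim/idxP => t b.
have sumL (A : 'M[C]_d) z u c v e : (sitepr z *m A) (idx u c) (idx v e) =
    (c == z)%:R * A (idx u c) (idx v e).
  rewrite mxE sum_bmx big_bool /=.
  by case: (c == z); case: u; rewrite /= ?(mul0r, mul1r, addr0, add0r).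
have sumR (A : 'M[C]_d) z u c v e : (A *m sitepr z) (idx u c) (idx v e) =
    (e == z)%:R * A (idx u c) (idx v e).
  by rewrite -[A *m _]trmxK trmx_mul sitepr_tr mxE sumL mxE.
rewrite sumR sumL.
have -> : (g *m sitepr x *m g^t*) (idx s a) (idx t b) =
    (s == t)%:R * (f s a x * (f s b x)^*).
  rewrite mxE sum_idx (bigD1 x) //= big1 ?addr0 => [|c /negPf cx].
    rewrite !sumR !gE !gCE eqxx /=.
    by case: s; case: t; rewrite /= ?(mul0r, mul1r, mulr0, addr0, add0r).
  by rewrite !sumR cx !mul0r addr0.
rewrite [in RHS]mxE bmxE.
case: (eqVneq b y) => [->|/negPf neq_by]; last first.
  by case: (eqVneq a b) => [->|_]; rewrite ?neq_by !mul0r ?mul1r ?mulr0.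
case: (eqVneq a y) => [->|_]; last by rewrite !mul0r !mulr0.
by case: (eqVneq s t) => [->|_]; rewrite /= ?mul0r ?mulr0 // !mul1r fflat mulr1.
Qed.

Section Spreading.
Variable g : 'M[C]_d.
Hypothesis gE : forall x y : 'I_m,
  sitepr y *m (g *m sitepr x *m g^t*) *m sitepr y = m%:R^-1 *: sitepr y.
Hypothesis m_gt0 : (0 < m)%N.
Let G x : 'M[C]_d := g *m sitepr x *m g^t*.

Let G_trC x : (G x)^t* = G x.
Proof. by rewrite /G !trmxC_mul trmxCK sitepr_trC mulmxA. Qed.

Let m_neq0 : m%:R != 0 :> C. Proof. by rewrite pnatr_eq0 -lt0n. Qed.

Lemma tr_sitepr_spread x y : \tr (sitepr y *m G x) = 2 / m%:R.
Proof.
have -> : sitepr y = sitepr y *m sitepr y by rewrite sitepr_mul eqxx scale1r.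
by rewrite -mulmxA mxtrace_mulC gE mxtraceZ tr_sitepr mulrC.
Qed.

Lemma tr_sitepr_spread2 x y :
  \tr (G x *m sitepr y *m G x *m sitepr y) = 2 / m%:R ^+ 2.
Proof.
have {1}-> : sitepr y = sitepr y *m sitepr y by rewrite sitepr_mul eqxx scale1r.
rewrite mulmxA -[_ *m G x *m _]mulmxA -[_ *m (G x *m _)]mulmxA.
rewrite [sitepr y *m (G x *m _)]mulmxA gE -scalemxAr mxtraceZ.
rewrite -mulmxA sitepr_mul eqxx scale1r mxtrace_mulC tr_sitepr_spread.
by field.
Qed.

Lemma sum2N (c : C) : \sum_(x < m) \sum_(y < m) c = m%:R ^+ 2 * c.
Proof. by rewrite !sumN mulrA expr2. Qed.

(** All m^2 pairs of sites contribute equally, 4/m^2 or 2/m^2. The resulting four traces 4, 2, 2, 4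
    are 2/d times the Gram matrix of [D1op] and [D2op]. *)
Lemma tr_D1_tw_D1 : \tr (D1op *m tw g D1op) = 4.
Proof.
rewrite linear_sum /= mulmx_suml raddf_sum /=.
under eq_bigr => y _.
  rewrite mulmx_sumr raddf_sum /=.
  under eq_bigr => x _ do rewrite tw_ketbra -/(G x) tr_ketbra2 G_trC sitepr_trC
    [X in _ * X]mxtrace_mulC tr_sitepr_spread.
  over.
by rewrite sum2N; field.
Qed.

Lemma tr_D2_tw_D1 : \tr (D2op *m tw g D1op) = 2.
Proof.
rewrite linear_sum /= mulmx_suml raddf_sum /=.
under eq_bigr => y _.
  rewrite mulmx_sumr raddf_sum /=.
  under eq_bigr => x _ do rewrite tw_ketbra -/(G x) mxtrace_mulC tr_ketbra_tens G_trC
    sitepr_tr tr_sitepr_spread2.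
  over.
by rewrite sum2N; field.
Qed.

Lemma tw_g_sitepr x : tw g (sitepr x *t sitepr x) = G x *t (G x)^cj.
Proof.
rewrite tw_tens; congr (_ *t _); rewrite !map_mxM sitepr_cj; congr (_ *m _).
by apply/matrixP => i j; rewrite !mxE /= conjCK.
Qed.

Let G_cj_tr x : ((G x)^cj)^T = G x.
Proof. by rewrite map_trmx; apply: G_trC. Qed.

Lemma tr_D1_tw_D2 : \tr (D1op *m tw g D2op) = 2.
Proof.
rewrite linear_sum /= mulmx_suml raddf_sum /=.
under eq_bigr => y _.
  rewrite mulmx_sumr raddf_sum /=.
  under eq_bigr => x _ do rewrite tw_g_sitepr tr_ketbra_tens G_cj_tr sitepr_trC
    mxtrace_mulC (mulmxA (G x)) (mulmxA (G x)) tr_sitepr_spread2.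
  over.
by rewrite sum2N; field.
Qed.

Lemma tr_D2_tw_D2 : \tr (D2op *m tw g D2op) = 4.
Proof.
rewrite linear_sum /= mulmx_suml raddf_sum /=.
under eq_bigr => y _.
  rewrite mulmx_sumr raddf_sum /=.
  under eq_bigr => x _ do rewrite tw_g_sitepr tensmx_mul tr_tens tr_sitepr_spread
     -[\tr (_ *m _^cj)]mxtrace_tr trmx_mul G_cj_tr sitepr_tr mxtrace_mulC tr_sitepr_spread.
  over.
by rewrite sum2N; field.
Qed.

End Spreading.
End SymplecticTwirl.

(** * Averaging into the span of the identity, [Wop] and [Fop] *)

Section IsotropicTwirl.
Variables (C : numClosedFieldType) (m : nat).
Local Notation d := (m + m)%N.
Local Notation op := 'M[C]_(d * d).
Local Notation N := (d%:R : C).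
Local Notation Om := (Omega C d).
Local Notation sitepr := (sitepr C).
Local Notation Wop := (Wop C m).
Local Notation Fop := (Fop C m).
Local Notation D1op := (D1op C m).
Local Notation D2op := (D2op C m).
Implicit Types (X Y : op) (U : 'M[C]_d) (x : 'I_m).
Lemma avg_closed_fixed_traces (S : op -> Prop) (Bs : seq op) X : avg_closed S ->
  avg_closed (fun Y => S Y /\ forall B, B \in Bs -> \tr (B *m Y) = \tr (B *m X)).
Proof.
move=> avgS T t0 Y SY; split; first by apply: avgS => // t; case: (SY t).
by move=> B BB; apply: (avg_closed_tr (c := \tr (B *m X)) t0) => t; apply: (SY t).2.
Qed.

Definition isotropic_op (al be ga : C) : op := al *: 1%:M + be *: Wop + ga *: Fop.

(** X is mixed with its conjugate by g, and the mixture is averaged again. The outcome lies in the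
    five-dimensional family, so comparing five traces identifies it with an operator without [D1op]
    and [D2op] terms. *)
Lemma twirled_twirl (S : op -> Prop) X : (1 < m)%N -> avg_closed S ->
  (forall U Z, symplectic U -> S Z -> S (tw U Z)) -> S X -> twirled X ->
  exists al be ga, S (isotropic_op al be ga) /\
    forall B, B \in [:: 1%:M; Wop; Fop] ->
      \tr (B *m isotropic_op al be ga) = \tr (B *m X).
Proof.
move=> m_gt1 avgS Ss SX /(twirled_span m_gt1)[al [be [ga [de [ep EX]]]]].
have m_gt0 := ltnW m_gt1.
have [g gs gE] := exists_spreading C m_gt0; have gu := gs.1.
(* The identity gets weight 1 / (d + 1) and [g] weight d / (d + 1). *)
pose X2 : op := #|'I_d.+1|%:R^-1 *:
  \sum_(t < d.+1) (if t == ord0 then X else tw g X).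
have SX2 : S X2 by apply: avgS => [|t]; [exact: ord0 | case: ifP => _ //; apply: Ss].
pose Bs : seq op := [:: 1%:M; Wop; Fop; D1op; D2op].
pose S2 Y := S Y /\ forall B, B \in Bs -> \tr (B *m Y) = \tr (B *m X2).
have fixB U B : site_symp U -> B \in Bs -> tw U B = B.
  move=> Us; have [Uu Usp _] := Us; rewrite !inE.
  case/or4P => [/eqP->|/eqP->|/eqP->|/orP[/eqP->|/eqP->]].
  - exact: tw_id.
  - exact: tw_W.
  - exact: tw_F.
  - exact: tw_D1.
  - exact: tw_D2.
have [|U Z Us [SZ tZ]||Y [SY tY] /(twirled_span m_gt1)[al2 [be2 [ga2 [de2 [ep2 EY]]]]]] :=
  @exists_twirled C m S2 X2.
- exact: avg_closed_fixed_traces.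
- split; first by apply: Ss => //; apply: site_symp_symplectic.
  by move=> B BB; rewrite tr_tw_inv ?tZ ?fixB //; case: Us.
- by split.
have trX2 B : \tr (B *m X2) =
    (N + 1)^-1 * (\tr (B *m X) + N * \tr (B *m tw g X)).
  rewrite -scalemxAr mxtraceZ card_ord -natr1; congr (_ * _).
  rewrite big_ord_recl /= mulmxDr raddfD /= mulmx_sumr raddf_sum /=; congr (_ + _).
  by rewrite sumr_const card_ord mulr_natl.
have N1_neq0 : N + 1 != 0 by rewrite natr1 pnatr_eq0.
(* For the trace pairing, [D1op] projects to (1 + 2 W - F)/(d + 1) and [D2op] to (2 + W + F)/(d + 1)
   in the span of 1, W, F; the coefficients de and ep are redistributed accordingly. *)
pose al' := al + (de + 2 * ep) / (N + 1).
pose be' := be + (2 * de + ep) / (N + 1).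
pose ga' := ga + (ep - de) / (N + 1).
have trE B : \tr (B *m isotropic_op al' be' ga') =
    al' * \tr (B *m 1%:M) + be' * \tr (B *m Wop) + ga' * \tr (B *m Fop).
  by rewrite !mulmxDr !mxtraceD -!scalemxAr !mxtraceZ.
have trX B : \tr (B *m X) = al * \tr (B *m 1%:M) + be * \tr (B *m Wop)
    + ga * \tr (B *m Fop) + de * \tr (B *m D1op) + ep * \tr (B *m D2op).
  by rewrite {1}EX !mulmxDr !mxtraceD -!scalemxAr !mxtraceZ.
have trgX B : \tr (B *m tw g X) = al * \tr (B *m 1%:M) + be * \tr (B *m Wop)
    + ga * \tr (B *m Fop) + de * \tr (B *m tw g D1op) + ep * \tr (B *m tw g D2op).
  have -> : tw g X = al *: 1%:M + be *: Wop + ga *: Fop + de *: tw g D1op + ep *: tw g D2op.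
    by rewrite {1}EX !linearD !linearZ /= tw_id // tw_W // tw_F.
  by rewrite !mulmxDr !mxtraceD -!scalemxAr !mxtraceZ.
have trC (A B : op) (z : C) : \tr (A *m B) = z -> \tr (B *m A) = z.
  by rewrite mxtrace_mulC.
have sym_tr B : B \in [:: 1%:M; Wop; Fop] -> \tr (B *m tw g X) = \tr (B *m X).
  rewrite !inE => BB; apply: tr_tw_inv => //.
  by case/or3P: BB => /eqP->; [apply: tw_id | apply: tw_W | apply: tw_F].
have sym_tr2 B : B \in [:: 1%:M; Wop; Fop] -> \tr (B *m X2) = \tr (B *m X).
  move=> BB; rewrite trX2 sym_tr //; set t := \tr _.
  have -> : t + N * t = (N + 1) * t by ring.
  by rewrite mulKf.
have match3 B : B \in [:: 1%:M; Wop; Fop] ->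
    \tr (B *m isotropic_op al' be' ga') = \tr (B *m X).
  have [trDI trD'I] : \tr (D1op *m 1%:M) = N /\ \tr (D2op *m 1%:M) = 2 * N.
    by rewrite !mulmx1 tr_D1 tr_D2.
  rewrite !inE trE trX => /or3P[] /eqP->.
  - rewrite !mul1mx tr_I tr_W tr_F tr_D1 tr_D2 /al' /be' /ga'; field.
    by rewrite -natrD N1_neq0.
  - rewrite mulmx1 tr_W tr_WW tr_WF tr_WD1 tr_WD2 /al' /be' /ga'; field.
    by rewrite -natrD N1_neq0.
  - rewrite mulmx1 tr_F (trC _ _ _ (tr_WF C m)) tr_FF (trC _ _ _ (tr_D1F C m)) tr_FD2.
    rewrite /al' /be' /ga'; field.
    by rewrite -natrD N1_neq0.
(* Both sides lie in the span of the five operators. Three traces agree by the projection formula;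
   the other two use the traces of [tw g D1op] and [tw g D2op] and the weights 1/(d + 1), d/(d +
   1). *)
have YE : Y = isotropic_op al' be' ga'.
  apply/eqP; rewrite -subr_eq0; apply/eqP.
  have tr0 B : \tr (B *m isotropic_op al' be' ga') = \tr (B *m X2) -> B \in Bs ->
      \tr (B *m (Y - isotropic_op al' be' ga')) = 0.
    by move=> e BB; rewrite mulmxBr raddfB /= tY // e subrr.
  have tr03 B : B \in [:: 1%:M; Wop; Fop] ->
      \tr (B *m (Y - isotropic_op al' be' ga')) = 0.
    move=> BB; apply: tr0; first by rewrite match3 // sym_tr2.
    by move: BB; rewrite !inE => /or3P[]->; rewrite ?orbT.
  apply: (@twirled_eq0 C m _ (al2 - al') (be2 - be') (ga2 - ga') de2 ep2).
  - rewrite {1}EY /isotropic_op; move: {+}Wop {+}Fop {+}D1op {+}D2op 1%:M => W F D1 D2 I.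
    by apply/matrixP => i j; rewrite !mxE; ring.
  - by rewrite -[X in \tr X]mul1mx tr03 ?inE ?eqxx.
  - by rewrite tr03 ?inE ?eqxx ?orbT.
  - by rewrite tr03 ?inE ?eqxx ?orbT.
  - apply: tr0; last by rewrite !inE eqxx !orbT.
    rewrite trE trX2 trX trgX mulmx1 tr_D1 (trC _ _ _ (tr_WD1 C m)) tr_D1F tr_D1D1 tr_D1D2.
    rewrite (tr_D1_tw_D1 gE m_gt0) (tr_D1_tw_D2 gE m_gt0) /al' /be' /ga'; field.
    by rewrite -natrD N1_neq0.
  - apply: tr0; last by rewrite !inE eqxx !orbT.
    rewrite trE trX2 trX trgX mulmx1 tr_D2 (trC _ _ _ (tr_WD2 C m)) (trC _ _ _ (tr_FD2 C m))
      (trC _ _ _ (tr_D1D2 C m)) tr_D2D2.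
    rewrite (tr_D2_tw_D1 gE m_gt0) (tr_D2_tw_D2 gE m_gt0) /al' /be' /ga'; field.
    by rewrite -natrD N1_neq0.
exists al', be', ga'; rewrite -YE; split=> // B BB.
by rewrite YE match3.
Qed.

(** This plays the part of the Haar average over the unitary symplectic group: the result is
    isotropic, keeps the property S and has the same traces against the three invariant
    operators. *)
Lemma symplectic_twirl (S : op -> Prop) X : (1 < m)%N -> avg_closed S ->
  (forall U Z, symplectic U -> S Z -> S (tw U Z)) -> S X ->
  exists al be ga, S (isotropic_op al be ga) /\
    forall B, B \in [:: 1%:M; Wop; Fop] ->
      \tr (B *m isotropic_op al be ga) = \tr (B *m X).
Proof.
move=> m_gt1 avgS Ss SX.
pose S1 Y := S Y /\ forall B, B \in [:: 1%:M; Wop; Fop] -> \tr (B *m Y) = \tr (B *m X).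
have [|U Z Us [SZ tZ]||Y [SY tY] twY] := @exists_twirled C m S1 X.
- exact: avg_closed_fixed_traces.
- have Usp := site_symp_symplectic Us.
  split; first exact: Ss.
  move=> B BB; rewrite tr_tw_inv ?tZ //; first by case: Us.
  move: BB; rewrite !inE => /or3P[] /eqP->; [apply: tw_id | apply: tw_W | exact: tw_F].
    by case: Usp.
  by case: Usp.
- by split.
have [al [be [ga [Siso trs]]]] := twirled_twirl m_gt1 avgS Ss SY twY.
by exists al, be, ga; split=> // B BB; rewrite trs // tY.
Qed.

End IsotropicTwirl.

(** * Schmidt number and the reduction to Omega *)

Section SchmidtCone.
Variables (C : numClosedFieldType) (d : nat).
Local Notation op := 'M[C]_(d * d).
Implicit Types (X Y : op) (U M : 'M[C]_d) (k : nat).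

Lemma hermsymmxP n (A : 'M[C]_n) : reflect (A^t* = A) (A \is hermsymmx).
Proof.
apply: (iffP idP) => [/is_hermitianmxP H|H].
  by rewrite [RHS]H scale1r.
by apply/is_hermitianmxP; rewrite expr0 scale1r H.
Qed.

Lemma psdmx_ketbra n (xi : 'cV[C]_n) : psdmx (ketbra xi).
Proof.
split; first by apply/hermsymmxP; rewrite trmxC_mul trmxCK.
move=> v; have -> : v^t* *m ketbra xi *m v = (xi^t* *m v)^t* *m (xi^t* *m v).
  by rewrite trmxC_mul trmxCK !mulmxA.
by rewrite mxE big_ord1 2![in X in X * _]mxE mulrC mul_conjC_ge0.
Qed.

Lemma psdmx0 n : psdmx (0 : 'M[C]_n).
Proof.
split; first by apply/hermsymmxP; rewrite trmx0 map_mx0.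
by move=> v; rewrite mulmx0 mul0mx mxE.
Qed.

Lemma psdmxD n (A B : 'M[C]_n) : psdmx A -> psdmx B -> psdmx (A + B).
Proof.
move=> [/hermsymmxP hA pA] [/hermsymmxP hB pB]; split.
  by apply/hermsymmxP; rewrite trmxCD hA hB.
by move=> v; rewrite mulmxDr mulmxDl mxE addr_ge0.
Qed.

(** The unnormalized form of [schmidt_decomposable]: the weights are absorbed into the vectors and
    the trace is free, which makes sums and averages immediate. *)
Definition schmidt_cone k X : Prop :=
  exists n (M : 'I_n -> 'M[C]_d),
    (forall i, (\rank (M i) <= k)%N) /\ X = \sum_i ketbra (vecm (M i)).

Lemma schmidt_cone0 k : schmidt_cone k 0.
Proof. by exists 0%N, (fun=> 0); split=> [[]|] //; rewrite big_ord0. Qed.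

Lemma schmidt_coneD k X Y :
  schmidt_cone k X -> schmidt_cone k Y -> schmidt_cone k (X + Y).
Proof.
move=> [n [M [rM ->]]] [p [L [rL ->]]].
exists (n + p)%N, (fun i => match split i with inl j => M j | inr j => L j end).
split=> [i|]; first by case: split.
rewrite big_split_ord /=; congr (_ + _); apply: eq_bigr => i _.
  by rewrite (unsplitK (inl i)).
by rewrite (unsplitK (inr i)).
Qed.

Lemma mxrank_scale_leq (c : C) M : (\rank (c *: M) <= \rank M)%N.
Proof. exact/mxrankS/scalemx_sub. Qed.

Lemma vecmZ c M : vecm (c *: M) = c *: vecm M.
Proof. by apply/matrixP => i j; rewrite !mxE. Qed.

Lemma ketbraZ n (c : C) (xi : 'cV[C]_n) : ketbra (c *: xi) = (c * c^*) *: ketbra xi.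
Proof.
by rewrite /ketbra trmxCZ -scalemxAl -scalemxAr scalerA.
Qed.

Lemma sqrtC_conj (c : C) : 0 <= c -> sqrtC c * (sqrtC c)^* = c.
Proof.
by move=> c0; rewrite (CrealP (ger0_real _)) ?sqrtC_ge0 // -expr2 sqrtCK.
Qed.

Lemma schmidt_coneZ k c X : 0 <= c -> schmidt_cone k X -> schmidt_cone k (c *: X).
Proof.
move=> c0 [n [M [rM ->]]]; exists n, (fun i => sqrtC c *: M i); split=> [i|].
  exact: leq_trans (mxrank_scale_leq _ _) (rM i).
rewrite scaler_sumr; apply: eq_bigr => i _.
by rewrite vecmZ ketbraZ sqrtC_conj.
Qed.

Lemma schmidt_cone_tw k U X : schmidt_cone k X -> schmidt_cone k (tw U X).
Proof.
move=> [n [M [rM ->]]]; exists n, (fun i => U *m M i *m U^t*); split=> [i|].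
  apply: leq_trans (mxrankM_maxl _ _) _.
  exact: leq_trans (mxrankM_maxr _ _) (rM i).
by rewrite linear_sum; apply: eq_bigr => i _; rewrite /= tw_ketbra.
Qed.

Lemma decomposable_cone k X : schmidt_decomposable k X -> schmidt_cone k X.
Proof.
move=> [n [p [xi [p0 _ xiP ->]]]].
exists n, (fun i => sqrtC (p i) *: coef_mx (xi i)); split=> [i|].
  by apply: leq_trans (mxrank_scale_leq _ _) _; case: (xiP i).
by apply: eq_bigr => i _; rewrite vecmZ ketbraZ sqrtC_conj // coef_mxK.
Qed.

Lemma psdmx_cone k X : schmidt_cone k X -> psdmx X.
Proof.
move=> [n [M [_ ->]]]; apply: (big_ind (@psdmx C (d * d))) => [|A B|i _].
- exact: psdmx0.
- exact: psdmxD.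
- exact: psdmx_ketbra.
Qed.

Lemma tr_MM_ge0 M : 0 <= \tr (M^t* *m M).
Proof.
apply: sumr_ge0 => i _; rewrite mxE; apply: sumr_ge0 => j _.
by rewrite !mxE mulrC mul_conjC_ge0.
Qed.

Lemma cone_decomposable k X : (0 < k)%N -> (0 < d)%N ->
  schmidt_cone k X -> \tr X = 1 -> schmidt_decomposable k X.
Proof.
move=> k_gt0 d_gt0 [n [M [rM DX]]] trX.
pose i0 : 'I_d := Ordinal d_gt0.
pose p i := \tr ((M i)^t* *m M i).
have p0 i : 0 <= p i by apply: tr_MM_ge0.
(* A zero vector cannot be normalized. It has weight 0 and is replaced by a product vector, whose
   existence and rank 1 require d > 0 and k > 0. *)
pose xi i := if p i == 0 then vecm (delta_mx i0 i0) else (sqrtC (p i))^-1 *: vecm (M i).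
have s_neq0 i : p i != 0 -> sqrtC (p i) != 0 by rewrite sqrtC_eq0.
exists n, p, xi; split=> //.
- rewrite -trX DX raddf_sum; apply: eq_bigr => i _ /=.
  by rewrite /ketbra mxtrace_mulC dot_vecm trace_mx11 mxE mulr1n.
- move=> i; rewrite /xi; case: eqP => [_|/eqP pi0]; split.
  + rewrite /unit_vector dot_vecm; congr (_%:M).
    rewrite trmx_delta map_delta_mx mul_delta_mx /mxtrace (bigD1 i0) //= big1 => [|j /negPf ji].
      by rewrite mxE !eqxx addr0.
    by rewrite mxE ji andbF.
  + by rewrite /schmidt_rank vecmK mxrank_delta.
  + rewrite /unit_vector trmxCZ -scalemxAl -scalemxAr scalerA dot_vecm.
    rewrite -/(p i) scale_scalar_mx; congr (_%:M).
    have s2 := sqrtC_conj (p0 i); rewrite fmorphV -invfM [X in X^-1]mulrC s2.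
    by rewrite mulVf.
  + rewrite /schmidt_rank -vecmZ vecmK.
    exact: leq_trans (mxrank_scale_leq _ _) (rM i).
- rewrite DX; apply: eq_bigr => i _; rewrite /xi; case: eqP => [pi0|/eqP pi0].
    have vec0 : vecm 0 = 0 :> 'cV[C]_(d * d) by apply/matrixP => ? ?; rewrite !mxE.
    by rewrite pi0 scale0r (tr_conj_eq0 pi0) vec0 /ketbra mul0mx.
  by rewrite ketbraZ scalerA fmorphV -invfM sqrtC_conj // mulfV // scale1r.
Qed.

End SchmidtCone.

(** * Reality of expectation values, and the maximally entangled state *)

Section ExpectationValues.
Variables (C : numClosedFieldType) (d : nat).
Implicit Types (X : 'M[C]_(d * d)).

Lemma tr_herm_real n (A B : 'M[C]_n) : A^t* = A -> B^t* = B -> \tr (A *m B) \is Num.real.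
Proof.
move=> hA hB; apply/CrealP; rewrite -(trace_map_mx (@Num.conj C)) /=.
rewrite map_mxM -[\tr (_ *m _)]mxtrace_tr trmx_mul !map_trmx hA hB.
exact: mxtrace_mulC.
Qed.

Lemma flip_herm : (flip C d)^t* = flip C d.
Proof.
apply: entP => i j k l; rewrite {1}/ent 2!mxE -/(ent _ _ _ _ _) !ent_flip rmorph_nat.
by rewrite andbC [l == i]eq_sym [k == j]eq_sym.
Qed.

Lemma conjB_flip_herm (V : 'M[C]_d) : (conjB V (flip C d))^t* = conjB V (flip C d).
Proof. by rewrite /conjB !trmxC_mul trmxCK mulmxA flip_herm. Qed.

Lemma omega_ketE : omega_ket C d = (sqrtC d%:R)^-1 *: vecm 1%:M.
Proof.
congr (_ *: _); apply/matrixP => p z; rewrite ord1; case: (mxtens_indexP p) => i j.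
rewrite vecmE summxE (bigD1 i) //= big1 ?addr0 => [|k /negPf ki].
  by rewrite ket2E mxE eqxx /= eq_sym.
by rewrite ket2E eq_sym ki.
Qed.

Lemma sqrtC_inv_conj : (sqrtC (d%:R : C))^-1 * ((sqrtC d%:R)^-1)^* = d%:R^-1.
Proof. by rewrite fmorphV -invfM [X in X^-1]mulrC mulrC sqrtC_conj ?ler0n. Qed.

Lemma ketbra_omega : ketbra (omega_ket C d) = d%:R^-1 *: ketbra (vecm 1%:M).
Proof. by rewrite omega_ketE ketbraZ sqrtC_inv_conj. Qed.

Lemma omega_fidE X : omega_fid X = d%:R^-1 * \tr (ketbra (vecm 1%:M) *m X).
Proof.
by rewrite -mxtraceZ scalemxAl -ketbra_omega /ketbra -mulmxA mxtrace_mulC trace_mx11.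
Qed.

End ExpectationValues.

(** * Normal form of skew-symmetric unitary matrices *)

Section SkewUnitary.
Variables (C : numClosedFieldType) (m : nat).
Local Notation d := (m + m)%N.
Variables (V : 'M[C]_d) (V_unitary : V \is unitarymx) (V_skew : V^T = - V).

Lemma mx11_skew (A : 'M[C]_1) : A^T = - A -> A = 0.
Proof.
move=> skA; apply/matrixP => i j; rewrite !ord1 [RHS]mxE; apply: eqN_eq0.
by move/matrixP: skA => /(_ 0 0); rewrite !mxE.
Qed.

Lemma exists_orthonormal_row p (A : 'M[C]_(p, d)) : (p < d)%N ->
  exists2 x : 'rV[C]_d, x *m x^t* = 1%:M & x *m A^t* = 0.
Proof.
move=> ltpd; have : kermx (A^t*) != 0.
  rewrite kermx_eq0 -row_leq_rank -ltnNge.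
  exact: leq_ltn_trans (rank_leq_col _) ltpd.
move=> /rowV0Pn[x /sub_kermxP xA x0].
have x_gt0 := dotmx_is_dotmx x0; rewrite dotmxE in x_gt0.
set c := (x *m x^t*) 0 0 in x_gt0.
exists ((sqrtC c)^-1 *: x); last by rewrite -scalemxAl xA scaler0.
rewrite trmxCZ -scalemxAl -scalemxAr scalerA fmorphV -invfM sqrtC_conj ?ltW //.
by rewrite [x *m _]mx11_scalar -/c scale_scalar_mx mulVf // gt_eqF.
Qed.

(** Greedy construction: the new row x is taken orthogonal to the rows of X and of conj(X V). The
    latter means x V X^T = 0, while x V x^T = 0 holds by skewness. These 2l conditions leave room as
    long as l < m. *)
Lemma exists_isotropic_rows l : (l <= m)%N ->
  exists X : 'M[C]_(l, d), X *m X^t* = 1%:M /\ X *m V *m X^T = 0.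
Proof.
elim: l => [|l IHl] ltlm; first by exists 0; split; apply/matrixP => -[].
have [X [XX XVX]] := IHl (ltnW ltlm).
have ltd : (l + l < d)%N by rewrite -addSn leq_add // ltnW.
have [x xx xA] := exists_orthonormal_row (col_mx X ((X *m V)^cj)) ltd.
have [xX xXV] : x *m X^t* = 0 /\ x *m V *m X^T = 0.
  move: xA; rewrite tr_col_mx map_row_mx mul_mx_row -row_mx0 => /eq_row_mx[-> xA].
  split=> //; move: xA; rewrite trmxC_conj trmx_mul V_skew mulmxA mulmxN mulNmx.
  by move=> /eqP; rewrite oppr_eq0 => /eqP.
rewrite -addn1; exists (col_mx X x); split.
  rewrite tr_col_mx map_row_mx mul_col_row XX xx xX.
  have -> : X *m x^t* = 0 by rewrite -[X]trmxCK -trmxC_mul xX trmx0 map_mx0.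
  by rewrite -scalar_mx_block.
rewrite tr_col_mx mul_col_mx mul_col_row XVX xXV.
have -> : X *m V *m x^T = 0.
  apply: trmx_inj; rewrite !trmx_mul V_skew trmxK trmx0 mulNmx mulmxN mulmxA.
  by rewrite xXV oppr0.
rewrite (mx11_skew (A := x *m V *m x^T)) ?block_mx_const //.
  by rewrite !trmx_mul trmxK V_skew mulNmx mulmxN mulmxA.
Qed.

(** The m isotropic rows X together with the rows of conj(X V) form a unitary W such that W V W^T is
    [Omega]; then U = conj W. *)
Lemma skew_unitary_normal_form :
  exists2 U : 'M[C]_d, U \is unitarymx & V = U^T *m Omega C d *m U.
Proof.
have VV := unitarymxP V_unitary.
have [X [XX XVX]] := exists_isotropic_rows (leqnn m).
have cjT p q (A : 'M[C]_(p, q)) : A^T = (A^t*)^cj.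
  by apply/matrixP => i j; rewrite !mxE /= conjCK.
pose W : 'M[C]_d := col_mx X ((X *m V)^cj).
have WW : W *m W^t* = 1%:M.
  rewrite tr_col_mx map_row_mx mul_col_row XX trmxC_conj.
  have -> : X *m (X *m V)^T = 0.
    by rewrite trmx_mul V_skew mulNmx mulmxN mulmxA XVX oppr0.
  have -> : (X *m V)^cj *m X^t* = 0.
    by rewrite -map_mxM XVX map_mx0.
  have -> : (X *m V)^cj *m (X *m V)^T = 1%:M.
    by rewrite cjT -map_mxM trmxC_mul mulmxA -(mulmxA X) VV mulmx1 XX map_mx1.
  by rewrite -scalar_mx_block.
have WVW : W *m V *m W^T = Omega C d.
  rewrite Omega_block tr_col_mx mul_col_mx mul_col_row XVX.
  have -> : ((X *m V)^cj)^T = (X *m V)^t* by rewrite map_trmx.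
  have e1 : X *m V *m (X *m V)^t* = 1%:M.
    by rewrite trmxC_mul mulmxA -(mulmxA X) VV mulmx1 XX.
  have -> : (X *m V)^cj *m V *m X^T = - 1%:M.
    apply: trmx_inj; rewrite [LHS]trmx_mul trmxK trmx_mul V_skew mulNmx mulmxN mulmxA.
    have -> : ((X *m V)^cj)^T = (X *m V)^t* by rewrite map_trmx.
    by rewrite e1 linearN /= trmx1.
  have -> : (X *m V)^cj *m V *m (X *m V)^t* = 0.
    rewrite -mulmxA trmxC_mul (mulmxA V) VV mul1mx.
    by rewrite -map_mxM XVX map_mx0.
  by rewrite e1.
have WW' := mulmx1C WW.
exists (W^cj); first by rewrite conjC_unitary; apply/unitarymxP.
have -> : (W^cj)^T = W^t* by rewrite map_trmx.
have tWW : W^T *m W^cj = 1%:M by rewrite cjT -map_mxM WW' map_mx1.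
by rewrite -WVW !mulmxA WW' mul1mx -mulmxA tWW mulmx1.
Qed.

End SkewUnitary.

(** * The isotropic state with parameters a(V) and b(V) *)

Section IsotropicState.
Variables (C : numClosedFieldType) (m : nat).
Local Notation d := (m + m)%N.
Local Notation N := (d%:R : C).

Lemma avg_closed_cone k : avg_closed (@schmidt_cone C d k).
Proof.
move=> T t0 X SX; apply: schmidt_coneZ; first by rewrite invr_ge0 ler0n.
apply: (big_ind (@schmidt_cone C d k)) => //; first exact: schmidt_cone0.
exact: schmidt_coneD.
Qed.

(** For an isotropic operator of trace 1, al n - be n + ga n^2 is the expectation of the twisted
    flip and al + be n - ga the fidelity. Eliminating al by the trace condition recovers be; the
    next lemma recovers ga in the same way. *)
Lemma a_coef (n al be ga : C) : al * n ^+ 2 + be * n + ga * n = 1 ->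
  -1 + (al * n - be * n + ga * n ^+ 2) + (n ^+ 2 - n) * (al + be * n - ga) =
  (n ^+ 2 - n - 2) * (be * n).
Proof.
move=> t1; have t1' : al * n ^+ 2 = 1 - be * n - ga * n by rewrite -t1; ring.
by ring: t1'.
Qed.

Lemma b_coef (n al be ga : C) : al * n ^+ 2 + be * n + ga * n = 1 ->
  -1 + (n - 1) * (al * n - be * n + ga * n ^+ 2) + n * (al + be * n - ga) =
  (n ^+ 2 - n - 2) * (ga * n).
Proof.
move=> t1; have t1' : al * n ^+ 2 = 1 - be * n - ga * n by rewrite -t1; ring.
by ring: t1'.
Qed.

(** After conjugation by U (x) conj U, which turns V into [Omega], the twirl gives an isotropic
    operator in the cone. Its three preserved traces force it to be [rho_ab] with the parameters of
    rho. *)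
Lemma schmidt_cone_isotropic k (V : 'M[C]_d) (rho : 'M[C]_(d * d)) :
  (1 < m)%N -> V \is unitarymx -> V^T = - V -> \tr rho = 1 ->
  schmidt_cone k rho ->
  schmidt_cone k (rho_ab d (a_param V rho) (b_param V rho)) /\
  \tr (rho_ab d (a_param V rho) (b_param V rho)) = 1.
Proof.
move=> m_gt1 Vu Vs tr_rho cone_rho.
have [U Uu VE] := skew_unitary_normal_form Vu Vs.
have [al [be [ga [coneY trY]]]] := symplectic_twirl m_gt1 (@avg_closed_cone k)
  (fun U Z _ => @schmidt_cone_tw C d k U Z) (schmidt_cone_tw U cone_rho).
set Y := isotropic_op m al be ga in coneY trY.
have trBY B : \tr (B *m Y) = al * \tr (B *m 1%:M) + be * \tr (B *m Wop C m)
    + ga * \tr (B *m Fop C m).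
  by rewrite !mulmxDr !mxtraceD -!scalemxAr !mxtraceZ.
have n0 : N != 0 by rewrite pnatr_eq0 -lt0n addn_gt0 (ltnW m_gt1).
have t1 : al * N ^+ 2 + be * N + ga * N = 1.
  have := trY 1%:M; rewrite trBY !mul1mx tr_I tr_W tr_F mxtrace_tw // tr_rho.
  by apply; rewrite !inE eqxx.
have tw' : al * N + be * N ^+ 2 - ga * N = N * omega_fid rho.
  have := trY (Wop C m); rewrite trBY mulmx1 tr_W tr_WW tr_WF mulrN => ->.
    by rewrite tr_tw_inv ?tw_W // omega_fidE mulVKf.
  by rewrite !inE eqxx orbT.
have tf : al * N - be * N + ga * N ^+ 2 = flip_val V rho.
  have := trY (Fop C m); rewrite trBY mulmx1 tr_F tr_FF (mxtrace_mulC _ (Wop C m)).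
  rewrite tr_WF mulrN => ->; last by rewrite !inE eqxx !orbT.
  rewrite twT // tw_conjB_flip /flip_val; congr (\tr (conjB _ _ *m _)).
  rewrite trmxCK VE; congr (_ *m _ *m _).
  by apply/matrixP => i j; rewrite !mxE /= conjCK.
(* The denominator is (d - 2)(d + 1), nonzero because d > 2. *)
have D0 : N ^+ 2 - N - 2 != 0.
  have -> : N ^+ 2 - N - 2 = (N - 2) * (N + 1) by ring.
  rewrite mulf_neq0 ?natr1 ?pnatr_eq0 // subr_eq0 eqr_nat.
  by rewrite addnn -muln2 (eqn_pmul2r (n2 := 1)) // gtn_eqF.
have aE : a_param V rho = be * N.
  rewrite /a_param -tf; have -> : omega_fid rho = al + be * N - ga.
    by apply: (mulfI n0); rewrite -tw'; ring.
  by apply: (mulfI D0); rewrite mulVKf //; exact: a_coef.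
have bE : b_param V rho = ga * N.
  rewrite /b_param -tf; have -> : omega_fid rho = al + be * N - ga.
    by apply: (mulfI n0); rewrite -tw'; ring.
  by apply: (mulfI D0); rewrite mulVKf //; exact: b_coef.
have -> : rho_ab d (a_param V rho) (b_param V rho) = Y.
  rewrite /rho_ab aE bE tens1mx1 ketbra_omega scalerA mulfK // mulfK //.
  have -> : 1 - be * N - ga * N = al * N ^+ 2 by rewrite -[X in X - _ - _]t1; ring.
  by rewrite mulfK // expf_neq0.
split=> //; rewrite -[Y]mul1mx trY; last by rewrite !inE eqxx.
by rewrite mul1mx mxtrace_tw.
Qed.

End IsotropicState.

(** * The partial transpose inequality *)

Section TransposeBound.
Variables (C : numClosedFieldType) (d : nat).
Implicit Types (A B M X S V W : 'M[C]_d).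

Lemma tr_trmxC n (A : 'M[C]_n) : \tr (A^t*) = (\tr A)^*.
Proof. by rewrite trace_map_mx mxtrace_tr. Qed.

(* Cauchy-Schwarz against the orthogonal projection onto the row space. *)
Lemma norm_tr_le_rank S : \tr S * (\tr S)^* <= (\rank S)%:R * \tr (S^t* *m S).
Proof.
have ltr : (\rank S <= d)%N by apply: rank_leq_col.
set r := \rank S in ltr *.
have [U /unitarymxP Uu SU] : exists2 U : 'M[C]_(r, d), U \is unitarymx & S = S *m (U^t* *m U).
  exists (schmidt (row_base S)); first exact: schmidt_unitarymx.
  have SleU : (S <= schmidt (row_base S))%MS.
    by rewrite (eqmx_schmidt_free (row_base_free S)) eq_row_base.
  have [D SD] := submxP SleU.
  by rewrite mulmxA {2}SD -(mulmxA D) (unitarymxP (schmidt_unitarymx _ _)) // mulmx1.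
set P := U^t* *m U in SU.
have PP : P *m P = P by rewrite /P mulmxA -(mulmxA _ U) Uu mulmx1.
have Ph : P^t* = P by rewrite trmxC_mul trmxCK.
have trP : \tr P = r%:R by rewrite mxtrace_mulC Uu mxtrace1.
set t := \tr S; set z := \tr (S^t* *m S).
have trPS : \tr (P *m S) = t by rewrite mxtrace_mulC -SU.
have trSP : \tr (S^t* *m P) = t^*.
  by rewrite -[P]Ph -trmxC_mul tr_trmxC trPS.
have [r0|r_gt0] := posnP r.
  have S0 : S = 0 by apply/eqP; rewrite -mxrank_eq0 -/r r0.
  by rewrite r0 /t S0 mxtrace0 !mul0r.
have rC : (0 : C) < r%:R by rewrite ltr0n.
(* Cauchy-Schwarz is the nonnegativity of the squared norm of r S - t P, where tr(P S) = t and tr P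
   = r. *)
have := tr_MM_ge0 (r%:R *: S - t *: P).
have -> : (r%:R *: S - t *: P)^t* = r%:R *: S^t* - t^* *: P.
  by rewrite -scaleNr trmxCD !trmxCZ Ph rmorph_nat rmorphN scaleNr.
rewrite mulmxBl !mulmxBr -!scalemxAl -!scalemxAr !raddfB /= !mxtraceZ PP trP trPS trSP -/z.
rewrite [X in 0 <= X](_ : _ = r%:R * (r%:R * z - t * t^*)); last by ring.
by rewrite pmulr_rge0 // subr_ge0.
Qed.

(** Y = W X^T W^* has the trace and the norm of X, and tr(Y^* X) = tr(X^* Y) = c because the two
    signs from W^T = -W cancel. Thus S = X + Y has squared norm 2 (z + c) and rank at most 2k, while
    the last trace of the statement is -c; the rank bound for S is four times the claim. *)
Lemma skew_conj_bound k X W : W \is unitarymx -> W^T = - W -> (\rank X <= k)%N ->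
  0 <= k%:R * \tr (X^t* *m X) - \tr X * (\tr X)^* - k%:R * \tr ((X *m W)^t* *m (X *m W)^T).
Proof.
move=> /unitarymxP WW skW rX; have WW' := mulmx1C WW.
have trC : W^t* = - W^cj by rewrite skW map_mxN.
pose Y := W *m X^T *m W^t*; pose S := X + Y.
have rS : (\rank S <= k + k)%N.
  apply: leq_trans (mxrank_add _ _) (leq_add rX _).
  apply: leq_trans (mxrankM_maxl _ _) _; apply: leq_trans (mxrankM_maxr _ _) _.
  by rewrite mxrank_tr.
pose z := \tr (X^t* *m X); pose c := \tr (X^t* *m Y).
have trY : \tr Y = \tr X by rewrite mxtrace_mulC mulmxA WW' mul1mx mxtrace_tr.
have trYY : \tr (Y^t* *m Y) = z.
  rewrite /Y trmxC_mul trmxC_mul trmxCK.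
  have -> : W *m (X^T^t* *m W^t*) *m (W *m X^T *m W^t*) =
      W *m (X^T^t* *m (W^t* *m W) *m X^T) *m W^t* by rewrite !mulmxA.
  rewrite WW' mulmx1 mxtrace_mulC (mulmxA (W^t*)) WW' mul1mx.
  have -> : X^T^t* = X^cj by rewrite trmxK.
  by rewrite -mxtrace_tr trmx_mul trmxK map_trmx mxtrace_mulC.
have trXY : \tr (Y^t* *m X) = c.
  have WtT : (W^t*)^T = - W^t* by rewrite map_trmx trmxK trC opprK.
  have XtT : (X^T^t*)^T = X^t* by rewrite !trmxK map_trmx.
  rewrite /c /Y trmxC_mul trmxC_mul trmxCK -mxtrace_tr.
  move: WtT; set Wd := W^t* => WtT.
  rewrite trmx_mul trmx_mul trmx_mul WtT XtT skW !(mulNmx, mulmxN) opprK.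
  by rewrite !mulmxA -mulmxA mxtrace_mulC !mulmxA.
have trW : \tr ((X *m W)^t* *m (X *m W)^T) = - c.
  rewrite trmxC_mul /c /Y; set Wd := W^t*.
  rewrite trmx_mul skW mulNmx mulmxN raddfN /= mxtrace_mulC [in RHS]mxtrace_mulC.
  by rewrite !mulmxA.
have trSS : \tr (S^t* *m S) = 2 * (z + c).
  rewrite /S trmxCD mulmxDl !mulmxDr !mxtraceD trYY trXY -/z -/c; ring.
have trS : \tr S = 2 * \tr X by rewrite mxtraceD trY; ring.
have := norm_tr_le_rank S; rewrite trSS trS => H.
have zc : 0 <= 2 * (z + c) by rewrite -trSS tr_MM_ge0.
have {}H := le_trans H (ler_wpM2r zc (_ : (\rank S)%:R <= (k + k)%:R)).
rewrite trW -/z -(pmulr_rge0 _ (_ : (0 : C) < 4)) ?ltr0n //.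
have -> : 4 * (k%:R * z - \tr X * (\tr X)^* - k%:R * - c) =
  (k + k)%:R * (2 * (z + c)) - 2 * \tr X * (2 * \tr X)^*.
  by rewrite rmorphM rmorph_nat natrD; ring.
by rewrite subr_ge0 H // ler_nat.
Qed.

(** The right side minus the left side of inequality (1). It is additive in rho, which reduces
    positivity to pure states. *)
Definition reduction_gap k V (rho : 'M[C]_(d * d)) : 'M[C]_(d * d) :=
  k%:R *: (ptrace rho *t 1%:M) - (rho + k%:R *: conjB V (ptranspose rho)).

Lemma reduction_gapD k V rho sigma :
  reduction_gap k V (rho + sigma) = reduction_gap k V rho + reduction_gap k V sigma.
Proof.
have ptrD : ptrace (rho + sigma) = ptrace rho + ptrace sigma.
  apply/matrixP => i j; rewrite !mxE -big_split; apply: eq_bigr => l _.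
  by rewrite mxE.
have tensD A B : (A + B) *t (1%:M : 'M[C]_d) = A *t 1%:M + B *t 1%:M.
  by apply/matrixP => i j; rewrite !mxE mulrDl.
have ptD : ptranspose (rho + sigma) = ptranspose rho + ptranspose sigma.
  by apply/matrixP => i j; rewrite !mxE.
rewrite /reduction_gap ptrD tensD ptD /conjB mulmxDr mulmxDl !scalerDr.
by rewrite addrACA !opprD [in RHS]addrACA; congr (_ + _); rewrite addrACA.
Qed.

Lemma reduction_gap0 k V : reduction_gap k V 0 = 0.
Proof. by apply: (addrI (reduction_gap k V 0)); rewrite -reduction_gapD !addr0. Qed.

Lemma ptrace_ketbra M : ptrace (ketbra (vecm M)) = M *m M^t*.
Proof.
apply/matrixP => i j; rewrite mxE [RHS]mxE; apply: eq_bigr => l _.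
by rewrite -/(ent _ _ _ _ _) ent_ketbra !mxE.
Qed.

(** [vecm M] is M (x) 1 applied to the unnormalized maximally entangled vector, whose partial
    transpose is the flip. *)
Lemma ptranspose_ketbra M :
  ptranspose (ketbra (vecm M)) = (M *t 1%:M) *m flip C d *m (M *t 1%:M)^t*.
Proof.
apply: vecm_ext => N; rewrite trmxC_tens trmx1 map_mx1 -!mulmxA tensmx_vecm.
rewrite flip_vecm tensmx_vecm trmx1 !mulmx1.
apply/matrixP => p z; rewrite ord1; case: (mxtens_indexP p) => i j.
rewrite vecmE [LHS]mxE sum_pair exchange_big /= mxE; apply: eq_bigr => l _.
rewrite !mxE big_distrr; apply: eq_bigr => k _ /=.
rewrite vecmE mxE !mxtens_indexK /= -/(ent _ _ _ _ _) ent_ketbra !mxE.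
by rewrite mulrA.
Qed.

Lemma psdmx_reduction_gap_ketbra k V M : V \is unitarymx -> V^T = - V ->
  (\rank M <= k)%N -> psdmx (reduction_gap k V (ketbra (vecm M))).
Proof.
move=> Vu Vs rM; rewrite /reduction_gap ptrace_ketbra ptranspose_ketbra.
have -> : conjB V ((M *t 1%:M) *m flip C d *m (M *t 1%:M)^t*) =
    (M *t V) *m flip C d *m (M *t V)^t*.
  rewrite /conjB !mulmxA tensmx_mul mul1mx mulmx1 -[LHS]mulmxA -trmxC_mul.
  by rewrite tensmx_mul mul1mx mulmx1.
have trmxCB n (A B : 'M[C]_n) : (A - B)^t* = A^t* - B^t*.
  by rewrite linearB map_mxB.
split.
  apply/hermsymmxP; rewrite trmxCB trmxCD !trmxCZ rmorph_nat.
  rewrite !(trmxC_mul, trmxC_tens, trmxCK) trmx1 map_mx1 flip_herm.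
  by rewrite !mulmxA.
move=> v; rewrite -(coef_mxK v); move: (coef_mx v) => N.
have Wu : V^cj \is unitarymx by rewrite conjC_unitary.
have Ws : (V^cj)^T = - V^cj by rewrite map_trmx Vs map_mxN.
have rX : (\rank (M^t* *m N) <= k)%N.
  apply: leq_trans (mxrankM_maxl _ _) _.
  by rewrite mxrank_map mxrank_tr.
(* The expectation of the gap at [vecm N] is exactly this bound for X = M^* N and W = conj V. *)
have := skew_conj_bound Wu Ws rX; congr (0 <= _).
rewrite mulmxBr mulmxBl mulmxDr mulmxDl -!scalemxAr -!scalemxAl.
set q1 := (vecm N)^t* *m (_ *t _) *m _; set q2 := (vecm N)^t* *m ketbra _ *m _.
set q3 := (vecm N)^t* *m (_ *m _ *m _) *m _.
have -> : q1 = (\tr ((M^t* *m N)^t* *m (M^t* *m N)))%:M.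
  rewrite /q1 -mulmxA tensmx_vecm dot_vecm trmx1 mulmx1 trmxC_mul trmxCK.
  by rewrite !mulmxA.
have -> : q2 = (\tr (M^t* *m N) * (\tr (M^t* *m N))^*)%:M.
  rewrite /q2 /ketbra mulmxA -mulmxA !dot_vecm -scalar_mxM mulrC -tr_trmxC.
  by rewrite trmxC_mul trmxCK.
have -> : q3 = (\tr ((M^t* *m N *m V^cj)^t* *m (M^t* *m N *m V^cj)^T))%:M.
  have -> : q3 = ((M *t V)^t* *m vecm N)^t* *m (flip C d *m ((M *t V)^t* *m vecm N)).
    by rewrite /q3 trmxC_mul trmxCK !mulmxA.
  rewrite trmxC_tens tensmx_vecm flip_vecm dot_vecm.
  by have -> : (V^t*)^T = V^cj by rewrite map_trmx trmxK.
by rewrite !mxE eqxx !mulr1n opprD addrA.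
Qed.

Lemma psdmx_reduction_gap k V rho : V \is unitarymx -> V^T = - V ->
  schmidt_cone k rho -> psdmx (reduction_gap k V rho).
Proof.
move=> Vu Vs [n [M [rM ->]]].
rewrite (big_morph (reduction_gap k V) (@reduction_gapD k V) (reduction_gap0 k V)).
apply: (big_ind (@psdmx C (d * d))) => [|A B|i _].
- exact: psdmx0.
- exact: psdmxD.
- exact: psdmx_reduction_gap_ketbra.
Qed.

End TransposeBound.

Local Open Scope complex_scope.

(** The parameters are defined as elements of [R[i]], whereas [Sset] consists of pairs of reals.
    Part (2) therefore exhibits real a and b that map to them; they exist because a trace of a
    product of two Hermitian matrices is real. *)
Theorem proposition4p6 (R : realType) (d : nat) (d_ge4 : (4 <= d)%N)
    (d_even : ~~ odd d) (rho : 'M[R[i]]_(d * d)) (rho_state : quantum_state rho) :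
  (forall k : nat, (1 <= k <= d./2)%N -> (schmidt_number rho <= k)%N ->
     forall V : 'M[R[i]]_d, V \is unitarymx -> V^T = - V ->
       loewner_le (rho + k%:R *: conjB V (ptranspose rho))
                  (k%:R *: (ptrace rho *t 1%:M)))
  /\
  (forall V : 'M[R[i]]_d, V \is unitarymx -> V^T = - V ->
     exists a b : R,
       [/\ a%:C = a_param V rho,
           b%:C = b_param V rho
         & forall k : nat, (1 <= k <= d)%N -> (schmidt_number rho <= k)%N ->
             Sset d k (a, b)]).
Proof.
have cone_of k : (schmidt_number rho <= k)%N -> schmidt_cone k rho.
  by move=> SN; apply/decomposable_cone/schmidt_number_leP.
split=> [k _ /cone_of cone_rho V Vu Vs|]; first exact: psdmx_reduction_gap.
have [m dE] : exists m, d = (m + m)%N.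
  by exists d./2; rewrite addnn even_halfK.
subst d => V Vu Vs; have [[/hermsymmxP rho_herm _] tr_rho] := rho_state.
have m_gt1 : (1 < m)%N.
  by move: d_ge4; rewrite addnn -(leq_double 2).
have flip_real : flip_val V rho \is Num.real.
  by apply: tr_herm_real; rewrite ?conjB_flip_herm.
have fid_real : omega_fid rho \is Num.real.
  rewrite omega_fidE rpredM ?rpredV ?realn // tr_herm_real //.
  by rewrite trmxC_mul trmxCK.
have nat_real n : n%:R \is @Num.real R[i] by apply: realn.
have N_real : ((m + m)%:R ^+ 2 - (m + m)%:R - 2 : R[i])^-1 \is Num.real.
  by rewrite rpredV !rpredB ?rpredX.
have /complex_realP[a aE] : a_param V rho \is Num.real.
  by rewrite rpredM // !rpredD ?rpredM ?rpredN ?rpredB ?rpredX ?rpred1.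
have /complex_realP[b bE] : b_param V rho \is Num.real.
  by rewrite rpredM // !rpredD ?rpredM ?rpredN ?rpredB ?rpredX ?rpred1.
exists a, b; split=> // k /andP[k_gt0 _] /cone_of cone_rho.
have [cone_ab tr_ab] := schmidt_cone_isotropic m_gt1 Vu Vs tr_rho cone_rho.
have state_ab : quantum_state (rho_ab (m + m) (a_param V rho) (b_param V rho)).
  by split=> //; apply: psdmx_cone cone_ab.
rewrite /Sset /= -aE -bE; split=> //; apply/schmidt_number_leP => //.
by apply: cone_decomposable => //; rewrite addn_gt0 (ltnW m_gt1).
Qed.
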